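(* Let $\{\boldsymbol{Z}_n\}$ be an irreducible, non-singular lower Hessenberg branching process with $M_{i,i+1}>0$ for all $i\ge 0$. Assume that $\tilde{\boldsymbol q}>\boldsymbol 0$, and that $k\in\mathbb N$ is such that $$sp\big(\tilde M^{(k)}\big)>1\quad\text{and}\quad\nu\big({}^{(k)}\tilde M\big)\le1,$$ and that the block $\bar M_{21}$ (corresponding to $k$) contains only finitely many strictly positive entries. Then $$\boldsymbol q=\tilde{\boldsymbol q}<\boldsymbol 1\quad\text{if and only if}\quad{}^{(k)}\boldsymbol q={}^{(k)}\tilde{\boldsymbol q}=\boldsymbol 1.$$
   Context: Lower Hessenberg branching process (LHBP): a multitype Galton-Watson process with type set $\mathcal X=\mathbb N_0=\{0,1,2,\dots\}$, started from a single individual of type $\varphi_0$. Each individual lives one generation; independently of all others, an individual of type $i$ has at death $r_\ell$ children of type $\ell$ ($\ell\in\mathcal X$) with probability $p_i(\boldsymbol r)$, where $\boldsymbol r\in R_i:=\{\boldsymbol r\in\mathbb N_0^{\mathcal X}: r_\ell=0\ \forall \ell>i+1\}$. $\boldsymbol Z_n=(Z_{n,\ell})_{\ell\in\mathcal X}$ counts the individuals of each type in generation $n$. Progeny generating vector: $G_i(\boldsymbol s)=\sum_{\boldsymbol r\in R_i}p_i(\boldsymbol r)\prod_{j=0}^{i+1}s_j^{r_j}$. Mean progeny matrix: $M_{i,j}=\partial G_i/\partial s_j$ at $\boldsymbol 1$. Irreducible: in the directed graph on $\mathcal X$ with an edge $i\to j$ iff $M_{i,j}>0$ there is a path between any two vertices.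 Non-singular: there is $i$ with $\sum_{\boldsymbol v:|\boldsymbol v|=1}p_i(\boldsymbol v)<1$, $|\boldsymbol v|=\sum_\ell v_\ell$. Extinction probabilities: $q_i=\mathbb P(\lim_n\sum_\ell Z_{n,\ell}=0\mid\varphi_0=i)$ (global), $\tilde q_i=\mathbb P(\lim_n Z_{n,\ell}=0\ \forall\ell\mid\varphi_0=i)$ (partial); $\boldsymbol q=(q_i)$, $\tilde{\boldsymbol q}=(\tilde q_i)$. For vectors, $\boldsymbol x<\boldsymbol y$ means $x_i\le y_i$ for all $i$ with $x_i<y_i$ for at least one $i$. Partition $M=\begin{bmatrix}\tilde M^{(k)}&\bar M_{12}\\\bar M_{21}&{}^{(k)}\tilde M\end{bmatrix}$, where $\tilde M^{(k)}$ is the $(k+1)\times(k+1)$ north-west block (types $0,\dots,k$) and the other blocks are infinite. $sp(\cdot)$ is the spectral radius. The convergence norm of a nonnegative infinite matrix $N$ is $\nu(N)=\limsup_n\sqrt[n]{(N^n)_{ij}}$, which does not depend on $i,j$ when $N$ is irreducible; if $N$ is reducible, $\nu(N)\le1$ is understood as $\limsup_n\sqrt[n]{(N^n)_{ij}}\le1$ for all $i,j$. $\{{}^{(k)}\tilde{\boldsymbol Z}_n\}$ is the LHBP with mean progeny matrix ${}^{(k)}\tilde M$ whose sample paths are obtained from those of $\{\boldsymbol Z_n\}$ by immediately killing all offspring of type $i\le k$ and relabelling each type $i\ge k+1$ as $i-k-1$; ${}^{(k)}\boldsymbol q$ and ${}^{(k)}\tilde{\boldsymbol q}$ are its global and partial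 extinction probability vectors.
   Formalization: The assumption q̃ > 0 is taken componentwise (q̃_i > 0 for every type i) rather than in the stated vector order (≥ 0 everywhere, > 0 somewhere), under which the equivalence fails, e.g. when types above k carry an immortal recurrent walker. *)

(* Defs.v *)
From HB Require Import structures.
From mathcomp Require Import all_boot all_order all_algebra.
From mathcomp Require Import complex.
From mathcomp Require Import all_classical all_reals all_analysis.

Set Implicit Arguments.
Unset Strict Implicit.
Unset Printing Implicit Defensive.

Import Order.TTheory GRing.Theory Num.Theory.
Import numFieldNormedType.Exports.

Local Open Scope classical_set_scope.
Local Open Scope ring_scope.

(* An offspring vector r counts the children of each type: r l of type l.
   [hessenberg i] is the set R_i of vectors an individual of type i may have. *)
Definition offspring := nat -> nat.

Definition hessenberg (i : nat) : set offspring :=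
  [set r | forall l, (i.+1 < l)%N -> r l = 0%N].

Section progeny_distributions.
Context {R : realType}.
Implicit Types (p : nat -> offspring -> R) (M : nat -> nat -> R).

(* p i is used only on [hessenberg i]; its values elsewhere are irrelevant. *)
Definition progeny_distributions p : Prop :=
  (forall i r, hessenberg i r -> 0 <= p i r) /\
  (forall i, (\esum_(r in hessenberg i) (p i r)%:E)%E = 1%E).

(* The generating function G_i, for s in [0, 1]^nat (where the sum is finite). *)
Definition progeny_gen p (i : nat) (s : nat -> R) : R :=
  fine (\esum_(r in hessenberg i)
          (p i r * \prod_(j < i.+2) s j ^+ r j)%:E)%E.

(* M i j is the partial derivative of G_i with respect to s_j at 1.  It is
   one-sided because G_i is only defined on [0, 1]^nat.  In particular the
   entries of M are finite. *)
Definition mean_progeny_matrix p M : Prop :=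
  forall i j : nat,
    (progeny_gen p i (fun l => if l == j then t else 1) -
     progeny_gen p i (fun=> 1)) / (t - 1) @[t --> (1 : R)^'-] --> M i j.

Definition nonsingular p : Prop :=
  exists i,
    (\esum_(v in [set v | hessenberg i v /\ (\sum_(l < i.+2) v l)%N = 1%N])
       (p i v)%:E < 1)%E.

Definition irreducible M : Prop :=
  forall i j : nat, exists s : seq nat,
    path.path (fun a b => 0 < M a b) i s /\ last i s = j.

End progeny_distributions.

Section matrices.
Context {R : realType}.
Implicit Types M N : nat -> nat -> R.

Definition nw_block M (k : nat) : 'M[R]_k.+1 := \matrix_(i, j) M i j.

Definition se_block M (k : nat) : nat -> nat -> R :=
  fun i j => M (i + k.+1)%N (j + k.+1)%N.

(* The eigenvalues are taken in the complex numbers R[i]. *)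
Definition spectral_radius (n : nat) (A : 'M[R]_n) : R :=
  sup [set ComplexField.Normc.normc l | l in
        [set l : R[i] | eigenvalue (map_mx (real_complex R) A) l]].

(* Powers of a nonnegative infinite matrix, with values in [0, +oo]. *)
Fixpoint matrix_power N (n i j : nat) : \bar R :=
  if n is m.+1 then
    (\sum_(0 <= l <oo) (N i l)%:E * matrix_power N m l j)%E
  else ((i == j)%:R : R)%:E.

(* nu(N) <= 1.  The limsup is independent of i, j if N is irreducible, and the
   condition is required for all i, j if N is reducible. *)
Definition convergence_norm_le1 N : Prop :=
  forall i j : nat,
    (limn_esup (fun n => matrix_power N n i j `^ (n%:R^-1 : R)) <= 1)%E.

(* The block of rows > k and columns <= k has finitely many positive entries. *)
Definition finite_sw_block M (k : nat) : Prop :=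
  finite_set [set ij : nat * nat |
    [/\ (k < ij.1)%N, (ij.2 <= k)%N & 0 < M ij.1 ij.2]].

End matrices.

(* Ulam-Harris labels.  In the family tree of an ancestor of type i, the
   ancestor is [::] and [rcons u (l, m)] is the m-th child of type l of u. *)
Definition label := seq (nat * nat).

Definition label_type (i : nat) (u : label) : nat := last i (map fst u).

Definition children (xi : label -> offspring) (i : nat) (u : label)
    : seq label :=
  [seq rcons u (l, m) | l <- iota 0 (label_type i u).+2, m <- iota 0 (xi u l)].

(* The individuals of generation n of the tree started from type i, where xi u
   is the offspring vector of u and every child whose type is not in [keep] is
   killed at birth. *)
Fixpoint generation (keep : pred nat) (xi : label -> offspring) (i n : nat)
    : seq label :=
  if n is m.+1 then
    [seq v <- flatten [seq children xi i u | u <- generation keep xi i m]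
       | keep (label_type i v)]
  else [:: [::]].

(* Z_{n,l}, started from type i. *)
Definition population (xi : label -> offspring) (i n l : nat) : nat :=
  count (fun u => label_type i u == l) (generation predT xi i n).

(* The same for the process in which all offspring of type <= k are killed and
   type l + k + 1 is relabelled as l. *)
Definition killed_population (k : nat) (xi : label -> offspring) (i n l : nat)
    : nat :=
  count (fun u => label_type (i + k.+1) u == (l + k.+1)%N)
    (generation (fun t => (k < t)%N) xi (i + k.+1) n).

Section processes.
Context {d : measure_display} {T : measurableType d} {R : realType}.
Implicit Types (P : nat -> probability T R) (xi : label -> T -> offspring).

(* P i is the law of the process conditionally on the ancestor having type i,
   and xi u is the offspring vector of the individual u.  Under P i the family
   (xi u)_u is mutually independent and xi u has distribution p_t, where t is
   the type of u.  As the xi u are discrete, independence is the product rule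
   for their individual values. *)
Definition is_LHBP P xi (p : nat -> offspring -> R) : Prop :=
  [/\ forall u l, measurable_fun setT (fun w => xi u w l),
      forall i u r, hessenberg (label_type i u) r ->
        P i [set w | xi u w = r] = (p (label_type i u) r)%:E &
      forall i (us : seq label) (r : label -> offspring), uniq us ->
        P i [set w | forall u, u \in us -> xi u w = r u] =
        (\prod_(u <- us) P i [set w | xi u w = r u])%E].

(* Z n l is the number of individuals of type l in generation n. *)
Definition global_extinction (Z : nat -> nat -> nat) : Prop :=
  (\sum_(0 <= l <oo) ((Z n l)%:R : R)%:E)%E @[n --> \oo] --> 0%E.

Definition partial_extinction (Z : nat -> nat -> nat) : Prop :=
  forall l, ((Z n l)%:R : R) @[n --> \oo] --> (0 : R).

Definition ext_prob P xi (i : nat) : \bar R :=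
  P i [set w | global_extinction (population (xi ^~ w) i)].

Definition partial_ext_prob P xi (i : nat) : \bar R :=
  P i [set w | partial_extinction (population (xi ^~ w) i)].

Definition killed_ext_prob P xi (k i : nat) : \bar R :=
  P (i + k.+1)%N [set w | global_extinction (killed_population k (xi ^~ w) i)].

Definition killed_partial_ext_prob P xi (k i : nat) : \bar R :=
  P (i + k.+1)%N [set w | partial_extinction (killed_population k (xi ^~ w) i)].

End processes.

Definition vec_lt {R : realType} (x y : nat -> \bar R) : Prop :=
  (forall i, (x i <= y i)%E) /\ (exists i, (x i < y i)%E).

(* This is stronger than [vec_lt (fun=> 0%E) x].  Positivity of the vector of
   partial extinction probabilities must be understood in this sense: it has to
   exclude that some type never dies out locally.  Suppose types >= k + 1 have
   exactly one child of type >= k + 1, performing a recurrent nearest-neighbour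
   walk, with k + 1 sometimes also producing a child of type k, and types <= k
   die with positive probability but are supercritical.  Then both extinction
   probability vectors of the process agree and are positive at some but not
   all types, while those of the killed process vanish. *)
Definition vec_pos {R : realType} (x : nat -> \bar R) : Prop :=
  forall i, (0 < x i)%E.

(* Main.v *)
(* Call the types at most k low and the others high, and let the killed process be
   the one in which low offspring are removed.

   The low block is supercritical: if w is a right eigenvector of it for an
   eigenvalue of modulus > 1 and v = |w|, then s = 1 - eps v satisfies G(s) <= s for
   small eps, so the process restricted to low types survives with positive
   probability and some partial extinction probability is < 1.

   If the killed process dies out, then the two extinction events coincide, because
   after the last low individual only killed processes remain.

   Conversely, the killed process always dies out locally.  Fix a high type l and let
   X be the number of individuals of type l, descending from one of type l, with no
   individual of type l in between.  Since the convergence norm is at most 1, E X <= 1.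
   If P(X = 0) = 0 then l never disappears, against the positivity of the partial
   extinction probability at l.  Otherwise
     E s^X >= s + (1 - s)^2 P(X = 0)   for E X <= 1 and s in [0, 1],
   so that the line of descent through l is almost surely finite.  As types increase
   by at most one at a time, this passes from the diagonal to all pairs of types.
   If now the killed process survived with positive probability, then, only finitely
   many high types having low children, some late individual would have an infinite
   killed progeny without low children: there the whole process is partially but not
   globally extinct, and q < q~ at the type of that individual. *)

From HB Require Import structures.
Require Import Defs.
From mathcomp Require Import all_boot all_order all_algebra.
From mathcomp Require Import complex.
From mathcomp Require Import all_classical all_reals all_analysis.
From mathcomp Require Import zify ring lra.

Set Implicit Arguments.
Unset Strict Implicit.
Unset Printing Implicit Defensive.

Import Order.TTheory GRing.Theory Num.Theory.
Import numFieldNormedType.Exports.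

Local Open Scope classical_set_scope.
Local Open Scope ring_scope.

(** * Family trees *)

(* Entry l of x u is the number of children of type l of u.  Finite lists are used
   instead of [offspring] in order that x u ranges over a countable type. *)
Definition family := label -> seq nat.

HB.instance Definition _ := gen_eqMixin family.
HB.instance Definition _ := gen_choiceMixin family.
HB.instance Definition _ := isPointed.Build family (fun=> [::]).

Definition cylinder (us : seq label) (s : family) : set family :=
  [set x | forall u, u \in us -> x u = s u].

(** The empty set is included to get a pi-system: cylinders prescribing different values at a common
    label are disjoint. *)
Definition cylinders : set (set family) :=
  [set A | A = set0 \/ exists us s, A = cylinder us s].

Notation families := (g_sigma_algebraType cylinders).

(** The subtree of [u] seen from [u]. A family assigns offspring to every label, so this makes sense
    for unborn individuals too. *)
Definition shift (u : label) (x : families) : families := fun v => x (u ++ v).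

Lemma cylinder0 s : cylinder [::] s = setT.
Proof. by apply/seteqP; split=> // x _ u. Qed.

Lemma setI_closed_cylinders : setI_closed cylinders.
Proof.
move=> A B [->|[us [s ->]]]; first by move=> _; left; rewrite set0I.
move=> [->|[us' [s' ->]]]; first by left; rewrite setI0.
have [[x [xs xs']]|/forallNP nx] := pselect (exists x, cylinder us s x /\
  cylinder us' s' x).
  right; exists (us ++ us'), x; apply/seteqP; split=> y.
    move=> [ys ys'] u; rewrite mem_cat => /orP[uu|uu].
      by rewrite ys// xs.
    by rewrite ys'// xs'.
  move=> yx; split=> u uu; rewrite yx ?mem_cat ?uu ?orbT//.
    by rewrite xs.
  by rewrite xs'.
by left; rewrite -subset0 => x [xs xs']; apply: (nx x).
Qed.

Lemma measurable_cylinder us s : measurable (cylinder us s : set families).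
Proof. by apply: sub_sigma_algebra; right; exists us, s. Qed.

Section countable_combinations.
Context {d : measure_display} {T : measurableType d}.

Lemma measurable_exists (I : countType) (A : I -> T -> Prop) :
  (forall i, measurable [set x | A i x]) -> measurable [set x | exists i, A i
    x].
Proof.
move=> mA; have -> : [set x | exists i, A i x] = \bigcup_i [set x | A i x].
  by apply/seteqP; split=> x; case=> i; exists i.
by apply: countable_bigcupT_measurable.
Qed.

Lemma measurable_not (A : T -> Prop) :
  measurable [set x | A x] -> measurable [set x | ~ A x].
Proof. by move=> mA; exact: measurableC. Qed.

Lemma measurable_forall (I : countType) (A : I -> T -> Prop) :
  (forall i, measurable [set x | A i x]) -> measurable [set x | forall i, A i
    x].
Proof.
move=> mA; have -> : [set x | forall i, A i x] = [set x | ~ exists i, ~ A i x].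
  by apply/seteqP; split=> x /=; [move=> Ax; case=> i;
    apply|move/forallNP=> Ax i; exact: contrapT].
by apply/measurable_not/measurable_exists => i; exact/measurable_not.
Qed.

Lemma measurable_prop (Q : Prop) : measurable [set x : T | Q].
Proof.
have [q|q] := pselect Q.
  by rewrite (_ : [set _ | _] = setT)//; apply/seteqP; split.
by rewrite (_ : [set _ | _] = set0)//; apply/seteqP; split.
Qed.

Lemma measurable_and (A B : T -> Prop) : measurable [set x | A x] ->
  measurable [set x | B x] -> measurable [set x | A x /\ B x].
Proof. by move=> mA mB; exact: (measurableI _ _ mA mB). Qed.

Lemma measurable_imp (A B : T -> Prop) : measurable [set x | A x] ->
  measurable [set x | B x] -> measurable [set x | A x -> B x].
Proof.
move=> mA mB; have -> : [set x | A x -> B x] = ~` [set x | A x] `|` [set x | B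
  x].
  apply/seteqP; split=> x /=; last by case.
  by move=> AB; have [|] := pselect (A x); [right; exact: AB|left].
by apply: measurableU => //; exact: measurableC.
Qed.

Lemma measure_esum (R : realType) (m : {measure set T -> \bar R}) (I :
  countType)
  (F : I -> set T) : (forall i, measurable (F i)) -> trivIset setT F ->
  m (\bigcup_i F i) = \esum_(i in [set: I]) m (F i).
Proof.
(* [G] carries the sets along the codes of [I], with the empty set at numbers that encode nothing,
   so that sigma-additivity over [nat] applies. *)
move=> mF tF; pose G n : set T := if @pickle_inv I n is Some i then F i else
  set0.
have mG n : measurable (G n) by rewrite /G; case: pickle_inv.
have tG : trivIset setT G.
  move=> n m' _ _ [x []]; rewrite /G.
  case En : (pickle_inv n) => [i|]//; case Em : (pickle_inv m') => [j|]// Fi Fj.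
  have ij : i = j by apply: tF => //; exists x.
  have := pickle_invK (T := I) n; have := pickle_invK (T := I) m'.
  by rewrite En Em /= ij => -> ->.
have -> : \bigcup_i F i = \bigcup_n G n.
  apply/seteqP; split=> x [].
    by move=> i _ Fx; exists (pickle i) => //; rewrite /G pickleK_inv.
  by move=> n _; rewrite /G; case: pickle_inv => // i; exists i.
rewrite measure_semi_bigcup//; last exact: bigcupT_measurable.
rewrite nneseries_esumT//.
transitivity (\esum_(n in range (@pickle I)) m (G n)).
  rewrite [RHS]esum_mkcond; apply: eq_esum => n _; case: ifPn => //.
  rewrite notin_setE => nr; rewrite /G; case En : (pickle_inv n) => [i|]//.
  have := pickle_invK (T := I) n; rewrite En /= => ni.
  by exfalso; apply: nr; exists i.
rewrite esum_image; first by apply: eq_esum => i _; rewrite /G pickleK_inv.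
by move=> a b _ _; exact: (pcan_inj (@pickleK I)).
Qed.

End countable_combinations.

(** Any predicate [B] is allowed because there are only countably many lists of integers. *)
Lemma measurable_label (u : label) (B : seq nat -> Prop) :
  measurable [set x : families | B (x u)].
Proof.
rewrite (_ : [set x : families | _] = [set x : families | exists s, B s /\
  cylinder [:: u] (fun=> s) x]).
  apply: measurable_exists => s; apply: measurable_and;
    first exact: measurable_prop.
  exact: measurable_cylinder.
apply/seteqP; split=> x /=.
  by move=> Bx; exists (x u); split=> // v; rewrite inE => /eqP ->.
by move=> [s [Bs /(_ u)]]; rewrite mem_head => ->.
Qed.

Lemma shift_shift u v x : shift v (shift u x) = shift (u ++ v) x.
Proof. by apply/funext => w; rewrite /shift catA. Qed.

Lemma preimage_shift_cylinder u us s :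
  shift u @^-1` cylinder us s =
  cylinder [seq u ++ v | v <- us] (fun v => s (drop (size u) v)).
Proof.
apply/seteqP; split=> x /= xs v.
  by move=> /mapP[w wus ->]; rewrite drop_size_cat// -xs.
by move=> vus; rewrite /shift xs ?map_f// drop_size_cat.
Qed.

Lemma measurable_shift u (E : set families) :
  measurable E -> measurable [set x | E (shift u x)].
Proof.
suff /(_ measurableT) h : measurable_fun setT (shift u).
  by move=> mE; rewrite -[X in measurable X]setTI; exact: h.
apply: (@measurability _ _ families families setT (shift u) cylinders) => // _
  [A [->|[us [s ->]]] <-]; rewrite setTI.
  by rewrite preimage_set0.
by rewrite preimage_shift_cylinder; exact: measurable_cylinder.
Qed.

(** Tells whether [u] is born when children of types outside [keep] are killed. The root is never
    tested against [keep]; the default 0 means that there are no children of types beyond the end of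
    the list. *)
Fixpoint intree (keep : pred nat) (x : families) (u : label) : bool :=
  if u is c :: u' then
    [&& keep c.1, (c.2 < nth 0%N (x [::]) c.1)%N & intree keep (shift [:: c] x)
      u']
  else true.

Lemma intree_cat keep x u v :
  intree keep x (u ++ v) = intree keep x u && intree keep (shift u x) v.
Proof.
elim: u x => [//|c u IH] x /=.
by rewrite IH shift_shift -!andbA.
Qed.

Lemma intree_rcons keep x u c :
  intree keep x (rcons u c) =
  [&& intree keep x u, keep c.1 & (c.2 < nth 0%N (x u) c.1)%N].
Proof. by rewrite -cats1 intree_cat /= andbT /shift cats0. Qed.

Lemma intree_mono (keep keep' : pred nat) x u : (forall t, keep t -> keep' t) ->
  intree keep x u -> intree keep' x u.
Proof.
move=> kk; elim: u x => [//|c u IH] x /= /and3P[kc -> uT].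
by rewrite kk ?IH.
Qed.

Lemma measurable_intree keep u : measurable [set x | intree keep x u].
Proof.
elim: u => [|c u IH] /=; first exact: measurable_prop.
rewrite (_ : [set x | _] = [set x | (keep c.1 /\ (c.2 < nth 0%N (x [::]) c.1)%N)
   /\ intree keep (shift [:: c] x) u]).
  apply: measurable_and; last exact: measurable_shift IH.
  by apply: measurable_and; [exact: measurable_prop|exact: (measurable_label
    [::] (fun s => c.2 < nth 0%N s c.1)%N)].
apply/seteqP; split=> x /=; first by move=> /and3P[].
by move=> [[-> ->] ->].
Qed.

Lemma label_type_cat i u v :
  label_type i (u ++ v) = label_type (label_type i u) v.
Proof. by rewrite /label_type map_cat last_cat. Qed.

Lemma label_type_rcons i u c : label_type i (rcons u c) = c.1.
Proof. by rewrite /label_type map_rcons last_rcons. Qed.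

(** Generations being finite, this says that infinitely many individuals satisfy [a]. With [of_type]
    it is the survival of one type, with the constant [True] that of the whole tree. *)
Definition lives keep (a : label -> Prop) (x : families) : Prop :=
  forall N, exists u, [/\ intree keep x u, a u & (N <= size u)%N].

Definition of_type (i l : nat) : label -> Prop := fun u => label_type i u = l.

Lemma measurable_lives keep a : measurable [set x | lives keep a x].
Proof.
apply: measurable_forall => N; apply: measurable_exists => u.
rewrite (_ : [set x | _] = [set x | intree keep x u /\ (a u /\ (N <= size
  u)%N)]).
  by apply: measurable_and; [exact: measurable_intree|exact: measurable_prop].
by apply/seteqP; split=> x /=; [case|case=> ? []].
Qed.

Lemma lives_mono (keep keep' : pred nat) (a b : label -> Prop) x :
  (forall t, keep t -> keep' t) -> (forall u, a u -> b u) ->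
  lives keep a x -> lives keep' b x.
Proof.
move=> kk ab ax N; have [u [uT /ab bu Nu]] := ax N.
by exists u; split => //; exact: intree_mono uT.
Qed.

Lemma not_lives keep a x : ~ lives keep a x ->
  exists N, forall u, intree keep x u -> a u -> (size u < N)%N.
Proof.
move=> /existsNP [N /forallNP NP]; exists N => u uT au.
by rewrite ltnNge; apply/negP => Nu; apply: (NP u).
Qed.

(** One step of König's lemma: the root has finitely many children, and if [a] stopped below each of
    them, the largest bound would stop [a] altogether. *)
Lemma lives_child keep a x : lives keep a x ->
  exists c, intree keep x [:: c] /\ lives keep (fun v => a (c :: v)) (shift [::
    c] x).
Proof.
move=> ax; pose cs := [seq (b, m) | b <- iota 0 (size (x [::])), m <- iota 0
  (nth 0%N (x [::]) b)].
apply: contrapT => /forallNP nc.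
have /choice [N NP] (c : nat * nat) : exists N, intree keep x [:: c] ->
    forall v, intree keep (shift [:: c] x) v -> a (c :: v) -> (size v < N)%N.
  have [cT|] := pselect (intree keep x [:: c]); last by exists 0%N.
  have /not_lives [N NP] : ~ lives keep (fun v => a (c :: v)) (shift [:: c] x).
    by move=> cl; apply: (nc c).
  by exists N => _ v vT; exact: NP.
have [[|c v] [+ acv +]] := ax (\max_(c <- cs) N c).+1; first by [].
move=> /= /and3P[kc cc vT]; rewrite ltnNge => /negP; apply.
apply: (leq_trans (NP c _ v vT acv)); first by rewrite /= kc cc.
apply: leq_bigmax_seq => //; apply/allpairsPdep; exists c.1, c.2;
  rewrite !mem_iota /= add0n.
split; [|exact: cc|by case: (c)].
by rewrite ltnNge; apply/negP => /(nth_default 0%N) e; rewrite e in cc.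
Qed.

Lemma lives_level keep a x N : lives keep a x ->
  exists u, [/\ intree keep x u, size u = N & lives keep (fun v => a (u ++ v))
    (shift u x)].
Proof.
elim: N a x => [|N IH] a x ax; first by exists [::].
have [c [cT /IH [u [uT uN ul]]]] := lives_child ax.
exists (c :: u); split; [|by rewrite /= uN|by move: ul; rewrite shift_shift].
by rewrite (intree_cat keep x [:: c] u) cT.
Qed.

(** Take an individual beyond generation [N] below which [a] lives on. The ancestor satisfying [b]
    of one of its descendants in [a] sits before generation [N], hence is its own ancestor as well,
    and [a] lives on below it. *)
Lemma lives_cut keep (a b : label -> Prop) x N : lives keep a x ->
  (forall u, intree keep x u -> b u -> (size u < N)%N) ->
  (forall u, intree keep x u -> a u -> (0 < size u)%N -> exists v w, u = v ++ w
    /\ b v) ->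
  exists u, [/\ intree keep x u, b u & lives keep (fun v => a (u ++ v)) (shift
    u x)].
Proof.
move=> ax bN ab; have [u [uT uN ul]] := lives_level N.+1 ax.
have [v [vT av _]] := ul 0%N.
have uvT : intree keep x (u ++ v) by rewrite intree_cat uT.
have [|v1 [v2 [uvE bv1]]] := ab (u ++ v) uvT av; first by rewrite size_cat uN.
have v1T : intree keep x v1 by move: uvT; rewrite uvE intree_cat => /andP[].
have v1u : (size v1 <= size u)%N by rewrite uN; have := bN _ v1T bv1; lia.
exists v1; split => // N'; have {}uvE : u = v1 ++ drop (size v1) u.
  have := congr1 (take (size u)) uvE; rewrite take_size_cat// take_cat ltnNge
    v1u /= => e.
  by rewrite {2}e drop_size_cat.
have [w [wT aw Nw]] := ul N'; exists (drop (size v1) u ++ w); split.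
- move: uT; rewrite {1}uvE intree_cat => /andP[_ dT].
  by rewrite intree_cat dT shift_shift -uvE.
- by rewrite catA -uvE.
- by rewrite size_cat; lia.
Qed.

(** * The branching property *)

Section canonical.
Context {R : realType}.
Implicit Types (law : nat -> seq nat -> R) (mu : nat -> {measure set families
  -> \bar R}).

(* [law t s] is the probability that an individual of type t has s_l children
   of type l, for l < t + 2 = size s. *)
Definition branching_law law mu : Prop :=
  [/\ forall t s, 0 <= law t s,
      forall t s, size s != t.+2 -> law t s = 0 &
      forall i us s, uniq us ->
        mu i (cylinder us s) = (\prod_(u <- us) law (label_type i u) (s u))%:E].

Context (law : nat -> seq nat -> R) (mu : nat -> {measure set families -> \bar
  R}).
Hypothesis lawP : branching_law law mu.

Lemma mu_setT i : mu i setT = 1%E.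
Proof.
case: lawP => _ _ cyl; rewrite -[setT](cylinder0 (fun=> [::])) cyl//.
by rewrite big_nil.
Qed.

Lemma mu_le1 i A : measurable A -> (mu i A <= 1)%E.
Proof. by move=> mA; rewrite -(mu_setT i) le_measure ?inE. Qed.

Lemma mu_fin i A : measurable A -> mu i A \is a fin_num.
Proof.
move=> mA; rewrite ge0_fin_numE//; apply: le_lt_trans (mu_le1 i mA) _.
by rewrite ltry.
Qed.

Lemma mu_undup_cylinder i us s : mu i (cylinder us s) =
  (\prod_(u <- undup us) law (label_type i u) (s u))%:E.
Proof.
case: lawP => _ _ cyl; rewrite -cyl ?undup_uniq//; congr (mu i _).
by apply/seteqP; split=> x xs u uu; apply: xs; move: uu; rewrite mem_undup.
Qed.

Definition children_in (cs : seq (nat * nat)) (E : nat * nat -> set families) :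
  set families := [set x | forall c, c \in cs -> E c (shift [:: c] x)].

Lemma measurable_children_in cs E : (forall c, c \in cs -> measurable (E c)) ->
  measurable (children_in cs E).
Proof.
move=> mE; apply: measurable_forall => c.
have [ccs|ccs] := boolP (c \in cs).
  by apply: measurable_imp; [exact: measurable_prop|apply: measurable_shift;
    exact: mE].
by rewrite (_ : [set _ | _] = setT)//; apply/seteqP; split.
Qed.

(* The pi-lambda theorem, one child at a time. *)
Lemma mu_children i us s cs E : uniq us -> uniq cs ->
  (forall c, c \in cs -> measurable (E c)) ->
  (forall u c, u \in us -> c \in cs -> ohead u != Some c) ->
  mu i (cylinder us s `&` children_in cs E) =
  ((\prod_(u <- us) law (label_type i u) (s u))%:E *
   \prod_(c <- cs) mu c.1 (E c))%E.
Proof.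
elim: cs us s => [|c cs IH] us s uus /=.
  move=> _ _ _; rewrite big_nil mule1; case: lawP => _ _ cyl; rewrite -cyl//.
  by congr (mu i _); apply/seteqP; split=> x; [case|move=> ?; split=> // c].
move=> /andP[ccs ucs] mE usc.
have mE' c' : c' \in cs -> measurable (E c').
  by move=> c'cs; apply: mE; rewrite inE c'cs orbT.
pose F : set families := cylinder us s `&` children_in cs E.
have mF : measurable F.
  by apply: measurableI; [exact: measurable_cylinder|exact:
    measurable_children_in].
rewrite (_ : _ `&` _ = F `&` [set x | E c (shift [:: c] x)]); last first.
  apply/seteqP; split=> x.
    move=> [xs xE]; split; last by apply: xE; rewrite mem_head.
    by split=> // c' c'cs; apply: xE; rewrite inE c'cs orbT.
  move=> [[xs xE] xc]; split=> // c'; rewrite inE => /orP[/eqP -> //|].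
  exact: xE.
have KE : mu i F = ((\prod_(u <- us) law (label_type i u) (s u))%:E *
   \prod_(c <- cs) mu c.1 (E c))%E.
  by apply: IH => // u c' uus' c'cs; apply: usc => //; rewrite inE c'cs orbT.
rewrite big_cons muleCA -KE muleC.
(* The events on the subtree of [c] that factor out of [F] form a lambda-system, so it suffices to
   treat cylinders. *)
pose H := [set A : set families | measurable A /\
  mu i (F `&` [set x | A (shift [:: c] x)]) = (mu i F * mu c.1 A)%E].
suff /(_ (E c)) : <<s cylinders >> `<=` H.
  by move=> /(_ (mE c (mem_head _ _))) [].
have mS A : measurable A -> measurable (F `&` [set x | A (shift [:: c] x)]).
  by move=> mA; apply: measurableI => //; exact: measurable_shift.
have fS A : measurable A -> mu i (F `&` [set x | A (shift [:: c] x)]) \is a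
  fin_num.
  by move=> mA; apply: mu_fin; exact: mS.
have muF : mu i F \is a fin_num by exact: mu_fin.
apply: (lambda_system_subset setI_closed_cylinders) => //; last first.
  move=> _ [->|[vs [t ->]]].
    split; first exact: measurable0.
    rewrite (_ : _ `&` _ = set0) ?measure0 ?mule0//.
    by apply/seteqP; split=> // x [].
  split; first exact: measurable_cylinder.
  (* A cylinder in the subtree of [c] prescribes values at the labels [c :: v]. Merging these with
     [us] leaves an instance of the induction hypothesis, which is general in [us] and [s]. *)
  pose s' u := if ohead u == Some c then t (behead u) else s u.
  rewrite (_ : _ `&` _ = cylinder (us ++ [seq c :: v | v <- undup vs]) s' `&`
      children_in cs E); last first.
    apply/seteqP; split=> x.
      move=> [[xs xE] xt]; split=> // u; rewrite mem_cat => /orP[uu|].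
        by rewrite /s' (negbTE (usc _ _ uu (mem_head _ _))) xs.
      by move=> /mapP[v]; rewrite mem_undup => vvs ->; rewrite /s' /= eqxx -xt.
    move=> [xs xE]; split; first split=> //.
      move=> u uu; rewrite xs ?mem_cat ?uu// /s'.
      by rewrite (negbTE (usc _ _ uu (mem_head _ _))).
    move=> v vvs; rewrite /shift /= xs ?mem_cat; last first.
      by apply/orP; right; apply/mapP; exists v; rewrite ?mem_undup.
    by rewrite /s' /= eqxx.
  rewrite IH//.
  - rewrite big_cat big_map /= KE mu_undup_cylinder EFinM -!muleA;
    congr (_ * _)%E.
      congr EFin; apply: eq_big_seq => u uu; rewrite /s'.
      by rewrite (negbTE (usc _ _ uu (mem_head _ _))).
    rewrite [RHS]muleC; congr (_ * _)%E; congr EFin; apply: eq_bigr => v _.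
    by rewrite /s' /= eqxx.
  - rewrite cat_uniq uus/= map_inj_uniq ?undup_uniq ?andbT//;
    last by move=> ? ? [].
    apply/hasPn => _ /mapP[v _ ->]; apply/negP => /usc/(_ (mem_head _ _)).
    by rewrite /= eqxx.
  - move=> u c'; rewrite mem_cat => /orP[uu c'cs|/mapP[v _ ->] c'cs].
      by apply: usc => //; rewrite inE c'cs orbT.
    by apply: contra ccs => /eqP [->].
split=> //.
- split; first exact: measurableT.
  by rewrite mu_setT mule1; congr (mu i _); apply/seteqP; split=> x; [case|].
- move=> A B BA [mA HA] [mB HB]; split; first exact: measurableD.
  rewrite (_ : _ `&` _ = (F `&` [set x | A (shift [:: c] x)]) `\`
     (F `&` [set x | B (shift [:: c] x)])); last first.
    apply/seteqP; split=> x; first by move=> [Fx [Ax nBx]]; split=> // -[].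
    by move=> [[Fx Ax] nB]; split=> //; split=> // Bx; apply: nB.
  rewrite measureD//; try exact: mS; last first.
    by rewrite -ge0_fin_numE//; exact: fS.
  rewrite (_ : (F `&` [set x | A (shift [:: c] x)]) `&` (F `&` [set x | B
    (shift [:: c] x)]) = F `&` [set x | B (shift [:: c] x)]); last first.
    apply/seteqP; split=> x; first by case.
    by move=> [Fx Bx]; split; split=> //; exact: (BA _ Bx).
  rewrite measureD//; last by rewrite -ge0_fin_numE//; exact: mu_fin.
  rewrite (_ : A `&` B = B); last by apply/seteqP; split=> x; [case|move=> Bx;
    split=> //; exact: (BA _ Bx)].
  rewrite muleBr//; last by apply: fin_num_adde_defl; rewrite ?fin_numN;
    exact: mu_fin.
  by congr (_ - _)%E; [exact: HA|exact: HB].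
- move=> A0 ndA HA; pose A : (set families)^nat := A0.
  have mA n : measurable (A n) by have [] := HA n.
  have mU : measurable (\bigcup_n A n) by exact: bigcupT_measurable.
  split => //.
  have c1 : mu i (F `&` [set x | A n (shift [:: c] x)]) @[n --> \oo] -->
      mu i (F `&` [set x | (\bigcup_n A n) (shift [:: c] x)]).
    rewrite (_ : F `&` [set x | (\bigcup_n A n) _] =
      \bigcup_n (F `&` [set x | A n (shift [:: c] x)])); last first.
      apply/seteqP; split=> x; first by move=> [Fx [n _ Ax]]; exists n.
      by move=> [n _ [Fx Ax]]; split=> //; exists n.
    apply: nondecreasing_cvg_mu => [n||]; first exact: mS.
      by apply: bigcupT_measurable => n; exact: mS.
    move=> n m nm; apply/subsetPset => x [Fx Ax]; split=> //.
    by have /subsetPset := ndA n m nm; exact.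
  have c2 : mu i (F `&` [set x | A n (shift [:: c] x)]) @[n --> \oo] -->
      (mu i F * mu c.1 (\bigcup_n A n))%E.
    under eq_fun do rewrite (HA _).2.
    apply: cvgeZl => //; apply: nondecreasing_cvg_mu => //.
  by rewrite -(cvg_lim _ c1)// -(cvg_lim _ c2).
Qed.

Lemma mu_shift i u (E : set families) : measurable E ->
  mu i [set x | E (shift u x)] = mu (label_type i u) E.
Proof.
elim: u i E => [//|c u IH] i E mE.
rewrite (_ : [set x | _] = cylinder [::] (fun=> [::]) `&`
    children_in [:: c] (fun=> [set x | E (shift u x)])); last first.
  apply/seteqP; split=> x /=.
    by move=> Ex; split=> // c'; rewrite inE => /eqP -> /=; rewrite shift_shift.
  by move=> [_ /(_ c)]; rewrite mem_head /= shift_shift; exact.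
rewrite mu_children//; last by move=> c' _; exact: measurable_shift.
by rewrite big_nil big_seq1 mul1e IH.
Qed.

Lemma mu_root t s : mu t [set x | x [::] = s] = (law t s)%:E.
Proof.
case: lawP => _ _ /(_ t [:: [::]] (fun=> s) erefl); rewrite big_seq1 => <-.
congr (mu t _); apply/seteqP; split=> x /=; last by apply; rewrite mem_head.
by move=> xs u; rewrite inE => /eqP ->.
Qed.

(** * Expectations over the offspring of the root *)

Lemma mu_esum_root t (A : set families) : measurable A ->
  mu t A = \esum_(s in [set: seq nat]) mu t (A `&` [set x | x [::] = s]).
Proof.
move=> mA; rewrite -measure_esum.
- congr (mu t _); apply/seteqP; split=> x; last by move=> [s _ []].
  by move=> Ax; exists (x [::]).
- by move=> s; apply: measurableI => //; exact: (measurable_label [::] (fun s'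
  => s' = s)).
- by move=> s s' _ _ [x [[_ /= <-] [_ /= <-]]].
Qed.

Lemma esumZl (I : choiceType) (c : R) (a : I -> R) : 0 <= c -> (forall i, 0 <=
  a i) ->
  \esum_(i in [set: I]) (c * a i)%:E = (c%:E * \esum_(i in [set: I]) (a
    i)%:E)%E.
Proof.
move=> c0 a0; have le (b : R) (f : I -> R) : 0 <= b -> (forall i, 0 <= f i) ->
    (\esum_(i in [set: I]) (b * f i)%:E <= b%:E * \esum_(i in [set: I]) (f
      i)%:E)%E.
  move=> b0 f0; apply: ge_ereal_sup => _ [X [finX _] <-].
  rewrite (_ : \sum_(i \in X) (b * f i)%:E = b%:E * \sum_(i \in X) (f i)%:E)%E.
    by apply: lee_wpmul2l => //; apply: ereal_sup_ubound; exists X.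
  by rewrite ge0_mule_fsumr// => i; rewrite lee_fin f0.
apply/eqP; rewrite eq_le le//=.
have [->|cN0] := eqVneq c 0; first by rewrite mul0e; apply: esum_ge0 => i _;
  rewrite mul0r.
(* The converse inequality is [le] for the constant 1/c and the function c * a. *)
have := le c^-1 (fun i => c * a i); rewrite invr_ge0 => /(_ c0 (fun i =>
  mulr_ge0 c0 (a0 i))).
under eq_esum do rewrite mulKf//.
move=> h; apply: le_trans (lee_wpmul2l _ h) _; rewrite ?lee_fin//.
by rewrite muleA -EFinM divff// mul1e.
Qed.

Definition Ex t (f : seq nat -> R) : \bar R :=
  \esum_(s in [set: seq nat]) (law t s * f s)%:E.

Lemma law_ge0 t s : 0 <= law t s. Proof. by case: lawP. Qed.

Lemma Ex_ge0 t f : (forall s, 0 <= f s) -> (0 <= Ex t f)%E.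
Proof. by move=> f0; apply: esum_ge0 => s _; rewrite lee_fin mulr_ge0//
  law_ge0. Qed.

Lemma le_Ex t f g : (forall s, size s = t.+2 -> f s <= g s) -> (Ex t f <= Ex t
  g)%E.
Proof.
move=> fg; apply: le_esum => s _; rewrite lee_fin.
have [/fg ?|ns] := eqVneq (size s) t.+2; first by rewrite ler_wpM2l// law_ge0.
by case: lawP => _ -> //; rewrite !mul0r.
Qed.

Lemma eq_Ex t f g : (forall s, size s = t.+2 -> f s = g s) -> Ex t f = Ex t g.
Proof. by move=> fg; apply/eqP; rewrite eq_le !le_Ex// => s /fg ->. Qed.

Lemma ExD t f g : (forall s, 0 <= f s) -> (forall s, 0 <= g s) ->
  Ex t (fun s => f s + g s) = (Ex t f + Ex t g)%E.
Proof.
move=> f0 g0; rewrite /Ex -esumD; last 2 first.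
- by move=> s _; rewrite lee_fin mulr_ge0 ?law_ge0.
- by move=> s _; rewrite lee_fin mulr_ge0 ?law_ge0.
by apply: eq_esum => s _; rewrite mulrDr EFinD.
Qed.

Lemma ExZ t c f : 0 <= c -> (forall s, 0 <= f s) ->
  Ex t (fun s => c * f s) = (c%:E * Ex t f)%E.
Proof.
move=> c0 f0; rewrite /Ex -esumZl//; last by move=> s;
  rewrite mulr_ge0 ?law_ge0.
by apply: eq_esum => s _; rewrite mulrCA.
Qed.

Lemma Ex_sum t (r : seq nat) (Q : pred nat) (f : nat -> seq nat -> R) :
  (forall l s, 0 <= f l s) ->
  Ex t (fun s => \sum_(l <- r | Q l) f l s) = (\sum_(l <- r | Q l) Ex t (f
    l))%E.
Proof.
move=> f0; elim: r => [|l r IH].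
  rewrite big_nil /Ex esum1// => s _; by rewrite big_nil mulr0.
rewrite big_cons; under eq_Ex do rewrite big_cons.
by case: (Q l); rewrite -?IH// -ExD// => s; exact: sumr_ge0.
Qed.

Lemma Ex1 t : Ex t (fun=> 1) = 1%E.
Proof.
rewrite -(mu_setT t) (mu_esum_root t measurableT).
by apply: eq_esum => s _; rewrite setTI mu_root mulr1.
Qed.

Lemma Ex_cst t c : 0 <= c -> Ex t (fun=> c) = c%:E.
Proof.
move=> c0; transitivity (Ex t (fun=> c * 1)); first by apply: eq_Ex => s;
  rewrite mulr1.
by rewrite ExZ// Ex1 mule1.
Qed.

Lemma Ex_fin t f : (forall s, 0 <= f s <= 1) -> Ex t f \is a fin_num.
Proof.
move=> f01; rewrite ge0_fin_numE ?Ex_ge0//; last by move=> s;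
  case/andP: (f01 s).
apply: (@le_lt_trans _ _ (Ex t (fun=> 1))); last by rewrite Ex1 ltry.
by apply: le_Ex => s _; case/andP: (f01 s).
Qed.

Lemma Ex_compl t f : (forall s, 0 <= f s <= 1) ->
  Ex t (fun s => 1 - f s) = (1 - fine (Ex t f))%:E.
Proof.
move=> f01; have g01 s : 0 <= 1 - f s <= 1 by have /andP[? ?] := f01 s; lra.
have := Ex1 t; rewrite (_ : (fun=> 1) = (fun s => (1 - f s) + f s)); last first.
  by apply/funext => s; rewrite subrK.
rewrite ExD; last 2 first.
- by move=> s; case/andP: (g01 s).
- by move=> s; case/andP: (f01 s).
rewrite -(fineK (Ex_fin t f01)) -(fineK (Ex_fin t g01)) -EFinD => -[] h /=.
by congr EFin; lra.
Qed.

(** Given the list [s] at the root, finitely many children are concerned and [mu_children] applies;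
    the equal factors of children of one type collect into a power. Lists of a length other than t +
    2 have mass zero. *)
Lemma branching (keep : pred nat) t (D : nat -> set families) : (forall l,
  measurable (D l)) ->
  mu t [set x | forall c, keep c.1 -> (c.2 < nth 0%N (x [::]) c.1)%N ->
                 D c.1 (shift [:: c] x)] =
  Ex t (fun s => \prod_(l < t.+2 | keep l) (fine (mu l (D l))) ^+ nth 0%N s l).
Proof.
move=> mD; pose A : set families := [set x | forall c, keep c.1 ->
  (c.2 < nth 0%N (x [::]) c.1)%N -> D c.1 (shift [:: c] x)].
have mA : measurable A.
  apply: measurable_forall => c; apply: measurable_imp;
    first exact: measurable_prop.
  apply: measurable_imp; last exact: measurable_shift.
  exact: (measurable_label [::] (fun s => (c.2 < nth 0 s c.1)%N)).
rewrite (mu_esum_root t mA); apply: eq_esum => s _.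
have [ss|ns] := eqVneq (size s) t.+2; last first.
  case: (lawP) => _ l0 _; rewrite (l0 t)// mul0r; apply/eqP.
  rewrite eq_le measure_ge0 andbT.
  apply: (@le_trans _ _ (mu t [set x | x [::] = s]));
    last by rewrite mu_root l0.
  have mr : measurable [set x : families | x [::] = s] by exact:
    (measurable_label [::] (fun s' => s' = s)).
  by apply: le_measure; rewrite ?inE//; exact: measurableI.
pose cs := [seq (l, m) | l <- [seq l <- iota 0 t.+2 | keep l], m <- iota 0 (nth
  0%N s l)].
have csP c : (c \in cs) = keep c.1 && (c.2 < nth 0%N s c.1)%N.
  apply/allpairsPdep/idP => [[l [m [+ + ->]]]|].
    by rewrite mem_filter !mem_iota /= => /andP[-> _] /=.
  move=> /andP[kc cls]; exists c.1, c.2; split; last by case: (c).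
    rewrite mem_filter kc mem_iota /= add0n -ss ltnNge;
      apply/negP => /(nth_default 0%N) e.
    by rewrite e in cls.
  by rewrite mem_iota.
transitivity (mu t (cylinder [:: [::]] (fun=> s) `&` children_in cs (fun c => D
  c.1))).
  congr (mu t _); apply/seteqP; split=> x.
    move=> [Ax /= xs]; split; first by move=> u; rewrite inE => /eqP ->.
    by move=> c; rewrite csP => /andP[kc cc]; apply: Ax => //; rewrite xs.
  move=> [xs xE]; have xs' : x [::] = s by apply: xs; rewrite mem_head.
  by split=> // c kc; rewrite xs' => cc; apply: xE; rewrite csP kc.
rewrite mu_children//; last 2 first.
- apply: allpairs_uniq_dep => [|l _|[? ?] [? ?] _ _ /= [-> ->]]//;
  rewrite ?iota_uniq//.
  by rewrite filter_uniq// iota_uniq.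
- by move=> u c; rewrite inE => /eqP ->.
rewrite big_seq1 EFinM; congr (_ * _)%E.
rewrite big_allpairs_dep big_filter.
rewrite (_ : iota 0 t.+2 = index_iota 0 t.+2);
  last by rewrite /index_iota subn0.
rewrite big_mkord /= -prodEFin; apply: eq_bigr => l _.
rewrite big_const_seq count_predT size_iota iter_mule mule1.
by rewrite -[in LHS](fineK (mu_fin l (mD l))) -EFin_expe.
Qed.

Lemma mu_full i (A : set families) : (forall x, A x) -> mu i A = 1%E.
Proof. by move=> AT; rewrite -(mu_setT i); congr (mu i _); apply/seteqP;
  split. Qed.

Lemma mu_empty i (A : set families) : (forall x, ~ A x) -> mu i A = 0%E.
Proof. by move=> A0; rewrite (_ : A = set0) ?measure0//; apply/seteqP;
  split=> // x /A0. Qed.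

Lemma mu_null_exists i (I : countType) (A : I -> set families) :
  (forall j, measurable (A j)) -> (forall j, mu i (A j) = 0%E) ->
  mu i [set x | exists j, A j x] = 0%E.
Proof.
move=> mA A0; apply/negligibleP; first exact: measurable_exists.
rewrite (_ : [set x | _] = \bigcup_n (if @pickle_inv I n is Some j then A j
  else set0)).
  apply: negligible_bigcup => n; case: pickle_inv => [j|];
    last exact: negligible_set0.
  by apply/negligibleP => //; exact: A0.
apply/seteqP; split=> x [].
  by move=> j Aj; exists (pickle j) => //; rewrite pickleK_inv.
by move=> n _; case: pickle_inv => // j Aj; exists j.
Qed.

Lemma mu_null_sub i (A B : set families) : measurable A -> measurable B ->
  A `<=` B -> mu i B = 0%E -> mu i A = 0%E.
Proof.
move=> mA mB AB B0; apply/eqP; rewrite eq_le measure_ge0 andbT -B0.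
by apply: le_measure; rewrite ?inE.
Qed.

Lemma mu_nullU i (A B : set families) : measurable A -> measurable B ->
  mu i A = 0%E -> mu i B = 0%E -> mu i (A `|` B) = 0%E.
Proof.
move=> mA mB A0 B0; apply/negligibleP; first exact: measurableU.
by apply: negligibleU; exact/negligibleP.
Qed.

Lemma measurable_exists_shift i (Q : label -> Prop) (B : nat -> set families) :
  (forall j, measurable (B j)) ->
  measurable [set x | exists u, Q u /\ B (label_type i u) (shift u x)].
Proof.
move=> mB; apply: measurable_exists => u; apply: measurable_and;
  first exact: measurable_prop.
exact: measurable_shift.
Qed.

(** There are countably many labels, and the subtree of each has the law of its type. This transfers
    null events from subtrees to the whole tree. *)
Lemma mu_exists_shift i (Q : label -> Prop) (B : nat -> set families) :
  (forall j, measurable (B j)) ->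
  (forall u, Q u -> mu (label_type i u) (B (label_type i u)) = 0%E) ->
  mu i [set x | exists u, Q u /\ B (label_type i u) (shift u x)] = 0%E.
Proof.
move=> mB B0; have mQ u : measurable [set x | Q u /\ B (label_type i u) (shift
  u x)].
  by apply: measurable_and; [exact: measurable_prop|exact: measurable_shift].
apply: mu_null_exists => // u; have [Qu|nQ] := pselect (Q u);
  last by apply: mu_empty => x [].
apply: (@mu_null_sub _ _ [set x | B (label_type i u) (shift u x)]).
- exact: mQ.
- exact: measurable_shift.
- by move=> x [].
- by rewrite mu_shift// B0.
Qed.

Lemma mu_compl i (A : set families) : measurable A ->
  mu i (~` A) = (1 - mu i A)%E.
Proof.
move=> mA; rewrite -(mu_setT i) -setTD measureD//; first by rewrite setTI.
by apply: le_lt_trans (mu_le1 i measurableT) _; exact: ltry.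
Qed.

Definition well_sized i (x : families) : Prop :=
  forall u, size (x u) = (label_type i u).+2.

Lemma measurable_well_sized i : measurable [set x | well_sized i x].
Proof.
by apply: measurable_forall => u; exact: (measurable_label u (fun s => size s =
  _)).
Qed.

Lemma mu_well_sized i : mu i [set x | ~ well_sized i x] = 0%E.
Proof.
have mS t : measurable [set x : families | size (x [::]) <> t.+2].
  exact: (measurable_label [::] (fun s => size s <> t.+2)).
have S0 t : mu t [set x | size (x [::]) <> t.+2] = 0%E.
  pose A s : set families := [set x | size s <> t.+2 /\ x [::] = s].
  have mA s : measurable (A s).
    exact: (measurable_label [::] (fun s' => size s <> t.+2 /\ s' = s)).
  apply: (@mu_null_sub _ _ [set x | exists s, A s x]).
  - exact: mS.
  - exact: measurable_exists.
  - by move=> x xt; exists (x [::]).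
  apply: mu_null_exists => // s; have [st|st] := pselect (size s = t.+2).
    by apply: mu_empty => x [].
  apply: (@mu_null_sub _ _ [set x | x [::] = s]).
  - exact: mA.
  - exact: (measurable_label [::] (fun s' => s' = s)).
  - by move=> x [].
  - by rewrite mu_root; case: (lawP) => _ -> //; exact/eqP.
pose B t : set families := [set x | size (x [::]) <> t.+2].
apply: (@mu_null_sub _ _ [set x | exists u, True /\ B (label_type i u) (shift u
  x)]).
- by apply: measurable_not; exact: measurable_well_sized.
- exact: measurable_exists_shift.
- by move=> x /existsNP [u ux]; exists u; split=> //;
  rewrite /B /= /shift cats0.
- by apply: mu_exists_shift => // u _; exact: S0.
Qed.

(** The integrand of the generating function G_t at [z], with the variables of the killed types set
    to 1. *)
Definition pgf (keep : pred nat) t (z : nat -> R) (s : seq nat) : R :=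
  \prod_(l < t.+2 | keep l) z l ^+ nth 0%N s l.

Lemma pgf01 keep t z s : (forall l, 0 <= z l <= 1) -> 0 <= pgf keep t z s <= 1.
Proof.
move=> z01; apply/andP; split.
  by apply: prodr_ge0 => l _; rewrite exprn_ge0//; case/andP: (z01 l).
apply: prodr_ile1 => l _; have /andP[z0 z1] := z01 l.
by rewrite exprn_ge0//= exprn_ile1.
Qed.

Lemma ler_pgf (keep : pred nat) t z z' s : (forall l, keep l -> 0 <= z l <= z'
  l) ->
  pgf keep t z s <= pgf keep t z' s.
Proof.
move=> zz; apply: ler_prod => l kl; have /andP[z0 z1] := zz l kl.
by rewrite exprn_ge0//= lerXn2r ?nnegrE//; exact: le_trans z1.
Qed.

Context (M : nat -> nat -> R).
Hypothesis meanP : forall t j, Ex t (fun s => (nth 0%N s j)%:R) = (M t j)%:E.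

Lemma M_ge0 t j : 0 <= M t j.
Proof. by rewrite -lee_fin -meanP; apply: Ex_ge0. Qed.

Lemma Ex_mean (keep : pred nat) t (v : nat -> R) : (forall l, 0 <= v l) ->
  Ex t (fun s => \sum_(l < t.+2 | keep l) (nth 0%N s l)%:R * v l) =
  (\sum_(l < t.+2 | keep l) M t l * v l)%:E.
Proof.
move=> v0; have -> : (fun s : seq nat => \sum_(l < t.+2 | keep l) (nth 0%N s
  l)%:R * v l) =
    (fun s => \sum_(l <- iota 0 t.+2 | keep l) (nth 0%N s l)%:R * v l).
  by apply/funext => s; rewrite (_ : iota 0 t.+2 = index_iota 0 t.+2)
    ?big_mkord// /index_iota subn0.
rewrite Ex_sum; last by move=> l s; rewrite mulr_ge0.
rewrite (_ : iota 0 t.+2 = index_iota 0 t.+2);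
  last by rewrite /index_iota subn0.
rewrite big_mkord -sumEFin; apply: eq_bigr => l _.
rewrite EFinM -meanP muleC -ExZ//; apply: eq_Ex => s _; exact: mulrC.
Qed.

(** Weierstrass' product inequality, combined with Bernoulli's inequality for each power. *)
Lemma pgf_ge (keep : pred nat) t z s : (forall l, 0 <= z l <= 1) ->
  1 - pgf keep t z s <= \sum_(l < t.+2 | keep l) (nth 0%N s l)%:R * (1 - z l).
Proof.
move=> z01; rewrite /pgf.
have bern (a : R) n : 0 <= a <= 1 -> 1 - a ^+ n <= n%:R * (1 - a).
  move=> /andP[a0 a1]; elim: n => [|n IH]; first by rewrite expr0 subrr mul0r.
  have a2 : 0 <= a ^+ n <= 1 by rewrite exprn_ge0// exprn_ile1.
  rewrite exprS mulrS mulrDl mul1r; nra.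
suff : forall r : seq 'I_t.+2, 1 - \prod_(l <- r | keep l) z l ^+ nth 0%N s l <=
    \sum_(l <- r | keep l) (nth 0%N s l)%:R * (1 - z l) by apply.
elim=> [|l r IH]; first by rewrite !big_nil subrr.
rewrite !big_cons; case: ifP => // _.
set b := \prod_(_ <- r | _) _ in IH *.
have /andP[b0 b1] : 0 <= b <= 1.
  apply/andP; split.
    by apply: prodr_ge0 => j _; rewrite exprn_ge0//; case/andP: (z01 j).
  apply: prodr_ile1 => j _; have /andP[z0 z1] := z01 j.
  by rewrite exprn_ge0//= exprn_ile1.
have /andP[z0 z1] := z01 l.
have a2 : 0 <= z l ^+ nth 0%N s l <= 1 by rewrite exprn_ge0//= exprn_ile1.
have := bern (z l) (nth 0%N s l) (z01 l); nra.
Qed.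

(* The union bound over the children of the root. *)
Lemma Ex_pgf_ge (keep : pred nat) t z : (forall l, 0 <= z l <= 1) ->
  1 - fine (Ex t (pgf keep t z)) <= \sum_(l < t.+2 | keep l) M t l * (1 - z l).
Proof.
move=> z01; rewrite -lee_fin -Ex_compl; last by move=> s; exact: pgf01.
rewrite -(@Ex_mean keep t (fun l => 1 - z l)); last by move=> l; have := z01 l;
  lra.
by apply: le_Ex => s _; exact: pgf_ge.
Qed.

(** * Visits to a fixed type *)

(* For X with values in nat, A = P(X > 0), B = 1 - E s^X and m = E X satisfy
   these inequalities, which are stable under independent sums and mixtures. *)
Definition pgf_bounds (s a b m : R) : Prop :=
  [/\ 0 <= a <= 1, 0 <= b <= 1, (1 - s) * (1 - a) <= 1 - b &
      1 - b <= (1 - s) ^+ 2 * (1 - a) + (1 - s) * s * m].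

Lemma pgf_bounds1 s : 0 <= s <= 1 -> pgf_bounds s 1 1 0.
Proof. by move=> s01; split; rewrite ?ler01 ?lexx// !subrr !mulr0// addr0. Qed.

(** Write 1 - b b' = (1 - b) + (1 - b') - (1 - b)(1 - b'). The upper bounds control the first two
    terms, the lower bounds control the product, and the terms in (1 - s)^2 recombine exactly. *)
Lemma pgf_boundsM s a b m a' b' m' : 0 <= s <= 1 ->
  pgf_bounds s a b m -> pgf_bounds s a' b' m' ->
  pgf_bounds s (a * a') (b * b') (m + m').
Proof.
move=> /andP[s0 s1] [/andP[a0 a1] /andP[b0 b1] l1 u1] [/andP[a0' a1'] /andP[b0'
  b1'] l2 u2].
have AA : 0 <= (1 - a) * (1 - a') by rewrite mulr_ge0 ?subr_ge0.
have p0 : 0 <= (1 - s) * (1 - a) by rewrite mulr_ge0 ?subr_ge0.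
have p0' : 0 <= (1 - s) * (1 - a') by rewrite mulr_ge0 ?subr_ge0.
have BB : ((1 - s) * (1 - a)) * ((1 - s) * (1 - a')) <= (1 - b) * (1 - b').
  by rewrite ler_pM.
have bb : b * b' <= (1 - (1 - s) * (1 - a)) * (1 - (1 - s) * (1 - a')).
  by rewrite ler_pM//; lra.
have sA : (1 - s) * (1 - s) * ((1 - a) * (1 - a')) <= (1 - s) * ((1 - a) * (1 -
  a')).
  by rewrite ler_wpM2r//; nra.
split.
- by rewrite mulr_ge0//= mulr_ile1.
- by rewrite mulr_ge0//= mulr_ile1.
- lra.
- rewrite expr2 in u1 u2 *; lra.
Qed.

Lemma pgf_boundsX s a b m n : 0 <= s <= 1 ->
  pgf_bounds s a b m -> pgf_bounds s (a ^+ n) (b ^+ n) (n%:R * m).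
Proof.
move=> s01 abm; elim: n => [|n IH]; first by rewrite !expr0 mul0r;
  exact: pgf_bounds1.
by rewrite !exprS mulrS mulrDl mul1r; exact: pgf_boundsM.
Qed.

Lemma pgf_bounds_pgf (keep : pred nat) s t za zb zm w : 0 <= s <= 1 ->
  (forall l, pgf_bounds s (za l) (zb l) (zm l)) ->
  pgf_bounds s (pgf keep t za w) (pgf keep t zb w)
    (\sum_(l < t.+2 | keep l) (nth 0%N w l)%:R * zm l).
Proof.
move=> s01 zP; rewrite /pgf.
apply: (big_ind3 (pgf_bounds s)) => [|? ? ? ? ? ?|l _].
- exact: pgf_bounds1.
- exact: pgf_boundsM.
- exact: pgf_boundsX.
Qed.

(** All the inequalities are affine in (a, b, m), hence stable under averaging over the offspring
    list. *)
Lemma pgf_bounds_Ex (keep : pred nat) s t za zb zm : 0 <= s <= 1 ->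
  (forall l, 0 <= zm l) ->
  (forall l, pgf_bounds s (za l) (zb l) (zm l)) ->
  pgf_bounds s (fine (Ex t (pgf keep t za))) (fine (Ex t (pgf keep t zb)))
    (\sum_(l < t.+2 | keep l) M t l * zm l).
Proof.
move=> s01 zm0 zP.
have a01 w : 0 <= pgf keep t za w <= 1 by apply: pgf01 => l; case: (zP l).
have b01 w : 0 <= pgf keep t zb w <= 1 by apply: pgf01 => l; case: (zP l).
have fine01 f : (forall w, 0 <= f w <= 1) -> 0 <= fine (Ex t f) <= 1.
  move=> f01; rewrite fine_ge0 ?Ex_ge0//=; last by move=> w; case/andP: (f01 w).
  rewrite -lee_fin fineK ?Ex_fin// -(Ex1 t); apply: le_Ex => w _.
  by case/andP: (f01 w).
have [s0 s1] := andP s01.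
have h0 : 0 <= 1 - s by rewrite subr_ge0.
split; [exact: fine01|exact: fine01| |].
- rewrite -lee_fin EFinM -!Ex_compl// -ExZ//; last by move=> w;
  have /andP[_] := a01 w; lra.
  by apply: le_Ex => w _; have [] := pgf_bounds_pgf keep t w s01 zP.
- rewrite -lee_fin [X in (_ <= X)%E]EFinD (EFinM (_ ^+ 2)) (EFinM ((1 - s) *
  s)) -!Ex_compl// -(Ex_mean keep t zm0).
  rewrite -ExZ; [|by rewrite sqr_ge0|by move=> w; have /andP[_] := a01 w; lra].
  rewrite -ExZ; [|by rewrite mulr_ge0|by move=> w; apply: sumr_ge0 => l _;
    rewrite mulr_ge0].
  rewrite -ExD.
  + by apply: le_Ex => w _; have [] := pgf_bounds_pgf keep t w s01 zP.
  + by move=> w; rewrite mulr_ge0 ?sqr_ge0//; have /andP[_] := a01 w; lra.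
  + by move=> w; rewrite !mulr_ge0//; apply: sumr_ge0 => l _; rewrite mulr_ge0.
Qed.

Section embedded.
Context (keep : pred nat) (l : nat).

(* The generating function and the mean of the number of individuals of type l
   in the first t generations that have no proper ancestor of type l except
   possibly the root. *)
Fixpoint first_pgf (s : R) (t i : nat) : R :=
  if t is t'.+1 then
    fine (Ex i (pgf keep i (fun j => if j == l then s else first_pgf s t' j)))
  else 1.

Fixpoint first_mean (t i : nat) : R :=
  if t is t'.+1 then
    \sum_(j < i.+2 | keep j) M i j * (if (j : nat) == l then 1 else first_mean
      t' j)
  else 0.

Lemma first_mean_ge0 t i : 0 <= first_mean t i.
Proof.
elim: t i => [//|t IH] i /=; apply: sumr_ge0 => j _.
by rewrite mulr_ge0 ?M_ge0//; case: ifP.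
Qed.

Lemma first_pgf_bounds s t i : 0 <= s <= 1 ->
  pgf_bounds s (first_pgf 0 t i) (first_pgf s t i) (first_mean t i).
Proof.
move=> s01; have /andP[s0 s1] := s01.
elim: t i => [|t IH] i /=; first exact: pgf_bounds1.
apply: (@pgf_bounds_Ex keep s i (fun j => if j == l then 0 else first_pgf 0 t j)
  (fun j => if j == l then s else first_pgf s t j)
  (fun j => if j == l then 1 else first_mean t j)) => // j.
  by case: ifP => // _; exact: first_mean_ge0.
(* A child of type [l] contributes X = 1, that is, the triple (0, s, 1), for which both bounds are
   equalities. *)
case: ifP => // _; split; rewrite ?lexx ?ler01//; first by rewrite subr0 mulr1.
by rewrite subr0 !mulr1 expr2; lra.
Qed.

(** The upper bound of [pgf_bounds] at m <= 1, rearranged: the generating function exceeds the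
    diagonal by a margin quadratic in 1 - s. *)
Lemma first_pgf_ge s t i : 0 <= s <= 1 -> first_mean t i <= 1 ->
  s + (1 - s) ^+ 2 * first_pgf 0 t i <= first_pgf s t i.
Proof.
move=> s01 m1; have /andP[s0 s1] := s01.
have [_ _ _ u] := first_pgf_bounds t i s01.
have : (1 - s) * s * first_mean t i <= (1 - s) * s.
  by rewrite ler_piMr// mulr_ge0// subr_ge0.
rewrite expr2 in u *; lra.
Qed.

(** Visits to [l] on the ancestral line of [u]. The root leaves no letter in a label and is not
    counted. *)
Definition visits (u : label) : nat := count (fun c => c.1 == l) u.

Definition few_visits_until n t (x : families) : Prop :=
  forall u, intree keep x u -> (size u <= t)%N -> (visits u < n)%N.

(** From a root of type [l]: the embedded Galton-Watson process of the individuals of type [l],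
    whose generations count visits, has an empty generation [n]. *)
Definition few_visits n (x : families) : Prop :=
  forall u, intree keep x u -> (visits u < n)%N.

Lemma measurable_few_visits_until n t : measurable [set x | few_visits_until n
  t x].
Proof.
apply: measurable_forall => u; apply: measurable_imp;
  first exact: measurable_intree.
exact: measurable_prop.
Qed.

Lemma measurable_few_visits n : measurable [set x | few_visits n x].
Proof.
apply: measurable_forall => u; apply: measurable_imp;
  first exact: measurable_intree.
exact: measurable_prop.
Qed.

Lemma few_visits_untilS n t x : few_visits_until n.+1 t.+1 x <->
  forall c, keep c.1 -> (c.2 < nth 0%N (x [::]) c.1)%N ->
    few_visits_until (if c.1 == l then n else n.+1) t (shift [:: c] x).
Proof.
split=> [fx c kc cc u uT ut|fx [//|c u] /= /and3P[kc cc uT] ut].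
  have := fx (c :: u); rewrite /= kc cc uT ltnS => /(_ isT ut).
  by rewrite /visits /=; case: eqP.
by have := fx c kc cc u uT ut; rewrite /visits /=; case: eqP.
Qed.

Lemma mu_few_visits_until i n t : fine (mu i [set x | few_visits_until n.+1
  t.+1 x]) =
  fine (Ex i (pgf keep i (fun j => fine (mu j
    [set x | few_visits_until (if j == l then n else n.+1) t x])))).
Proof.
pose D j := [set x | few_visits_until (if j == l then n else n.+1) t x].
have mD j : measurable (D j) by exact: measurable_few_visits_until.
congr fine; rewrite -[RHS](branching keep i mD); congr (mu i _).
by apply/seteqP; split=> x /few_visits_untilS.
Qed.

Lemma first_pgf_le01 s t i : 0 <= s <= 1 -> 0 <= first_pgf s t i <= 1.
Proof. by move=> s01; case: (first_pgf_bounds t i s01). Qed.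

Lemma first_pgf0 t i : fine (mu i [set x | few_visits_until 1 t x]) = first_pgf
  0 t i.
Proof.
elim: t i => [|t IH] i.
  by rewrite mu_full// => x [|//].
rewrite mu_few_visits_until /=; congr (fine (Ex i (pgf keep i _))).
apply/funext => j; case: eqP => _; last exact: IH.
by rewrite mu_empty// => x /(_ [::] isT isT).
Qed.

(** Split at the first individuals of type [l]. Granting unlimited time to the trees below them only
    lowers the probability, whence an inequality. *)
Lemma few_visits_first_pgf n t i :
  first_pgf (fine (mu l [set x | few_visits n x])) t i <=
  fine (mu i [set x | few_visits_until n.+1 t x]).
Proof.
elim: t i => [|t IH] i.
  by rewrite (@mu_full i [set x | few_visits_until n.+1 0 x])// => x [|//].
rewrite mu_few_visits_until /=.
have s01 : 0 <= fine (mu l [set x | few_visits n x]) <= 1.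
  rewrite fine_ge0//= -lee_fin fineK ?mu_fin ?mu_le1//;
    exact: measurable_few_visits.
have z01 j : 0 <= fine (mu j [set x | few_visits_until (if j == l then n else
  n.+1) t x]) <= 1.
  rewrite fine_ge0//= -lee_fin fineK ?mu_fin ?mu_le1//;
    exact: measurable_few_visits_until.
apply: fine_le; rewrite ?Ex_fin//; try by move=> w; apply: pgf01.
  by move=> w; apply: pgf01 => j; case: ifP => // _; exact: first_pgf_le01.
apply: le_Ex => w _; apply: ler_pgf => j _; case: eqP => [->|_].
  have /andP[-> _] /= := s01; apply: fine_le.
  - by apply: mu_fin; exact: measurable_few_visits.
  - by apply: mu_fin; exact: measurable_few_visits_until.
  apply: le_measure; rewrite ?inE; [exact: measurable_few_visits|exact:
    measurable_few_visits_until|].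
  by move=> x fx u uT _; exact: fx.
by rewrite IH andbT; case/andP: (first_pgf_le01 t j s01).
Qed.

(** With s_n the probability of [few_visits n], the previous lemma bounds s_(n+1) below by E s_n^X,
    and [first_pgf_ge] applies. The time bound [t] is removed by continuity from above. *)
Lemma few_visits_step n : (forall t, first_mean t l <= 1) ->
  fine (mu l [set x | few_visits n x]) +
  (1 - fine (mu l [set x | few_visits n x])) ^+ 2 * fine (mu l [set x |
    few_visits 1 x])
  <= fine (mu l [set x | few_visits n.+1 x]).
Proof.
move=> m1; have mf := measurable_few_visits; have mfu :=
  measurable_few_visits_until.
have s01 : 0 <= fine (mu l [set x | few_visits n x]) <= 1.
  by rewrite fine_ge0//= -lee_fin fineK ?mu_fin ?mu_le1.
set s := fine (mu l [set x | few_visits n x]) in s01 *.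
rewrite -lee_fin fineK ?mu_fin//.
pose F t : set families := [set x | few_visits_until n.+1 t x].
have -> : [set x | few_visits n.+1 x] = \bigcap_t F t.
  apply/seteqP; split=> x; first by move=> fx t _ u uT _; exact: fx.
  by move=> fx u uT; exact: (fx (size u)).
have cF : mu l (F t) @[t --> \oo] --> mu l (\bigcap_t F t).
  apply: nonincreasing_cvg_mu => //.
  - by apply: le_lt_trans (mu_le1 l (mfu _ _)) _; exact: ltry.
  - by move=> t; exact: mfu.
  - by apply: bigcapT_measurable => t; exact: mfu.
  - move=> t t' tt'; apply/subsetPset => x fx u uT ut; apply: fx => //.
    exact: leq_trans ut tt'.
rewrite -(cvg_lim _ cF)//; apply: lime_ge; first by apply/cvg_ex; eexists;
  exact: cF.
apply: nearW => t; rewrite -(fineK (mu_fin l (mfu n.+1 t))) lee_fin.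
apply: le_trans (few_visits_first_pgf n t l);
  apply: le_trans (first_pgf_ge s01 (m1 t)).
rewrite lerD2l ler_wpM2l ?sqr_ge0// -first_pgf0; apply: fine_le;
  rewrite ?mu_fin//.
by apply: le_measure; rewrite ?inE// => x fx u uT _; exact: fx.
Qed.

(** If the event had probability a > 0, then s_n <= 1 - a for all n, so each step of
    [few_visits_step] would add at least a^2 s_1 and the s_n would be unbounded. *)
Lemma mu_unbounded_visits : (forall t, first_mean t l <= 1) ->
  (0 < mu l [set x | few_visits 1 x])%E ->
  mu l [set x | forall n, ~ few_visits n x] = 0%E.
Proof.
move=> m1 b0; have mf := measurable_few_visits.
set A := [set x | _].
have mA : measurable A by apply: measurable_forall => n; apply: measurable_not;
  exact: mf.
pose s n := fine (mu l [set x | few_visits n x]).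
pose a := fine (mu l A); apply/eqP; apply: contraTT isT => A0.
have a0 : 0 < a by rewrite fine_gt0// lt0e A0 measure_ge0 -ge0_fin_numE//
  mu_fin.
have {}b0 : 0 < s 1%N by rewrite fine_gt0// b0 -ge0_fin_numE// mu_fin//;
  exact: mf.
have sa n : s n <= 1 - a.
  rewrite -lee_fin EFinB !fineK; [|exact: mu_fin|by apply: mu_fin; exact: mf].
  rewrite -mu_compl//; apply: le_measure; rewrite ?inE;
    [exact: mf|exact: measurableC|].
  by move=> x fx /(_ n).
have sn n : n%:R * (a ^+ 2 * s 1%N) <= s n.
  elim: n => [|n IH]; first by rewrite mul0r fine_ge0.
  apply: le_trans (few_visits_step n m1); rewrite -/(s n) -/(s 1%N) mulrS
    mulrDl mul1r addrC.
  apply: lerD => //; rewrite ler_wpM2r ?(ltW b0)// lerXn2r ?nnegrE ?(ltW a0)//.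
    by have := sa n; lra.
  by have := sa n; lra.
have e0 : 0 < a ^+ 2 * s 1%N by rewrite mulr_gt0// exprn_gt0.
have [n nP] : exists n : nat, 1 < n%:R * (a ^+ 2 * s 1%N).
  exists (Num.bound (a ^+ 2 * s 1%N)^-1).
  rewrite -ltr_pdivrMr// mul1r; apply: archi_boundP; rewrite invr_ge0 ltW//.
by have := sa n; have := sn n; lra.
Qed.

Lemma visits_cat u v : visits (u ++ v) = (visits u + visits v)%N.
Proof. exact: count_cat. Qed.

Lemma visits_last u : (0 < visits u)%N ->
  exists u1 c u2, [/\ u = rcons u1 c ++ u2, c.1 = l & visits u2 = 0%N].
Proof.
elim/last_ind: u => [//|u c IH]; rewrite -cats1 visits_cat.
have [cl|cl] := eqVneq c.1 l.
  by move=> _; exists u, c, [::]; split=> //; rewrite cats0 cats1.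
rewrite {2}/visits /= (negbTE cl) !addn0 => /IH [u1 [c' [u2 [-> cl' v2]]]].
exists u1, c', (rcons u2 c); split=> //; first by rewrite -catA cats1.
by rewrite -cats1 visits_cat v2 /visits /= (negbTE cl).
Qed.

(* u ends with its only non-root individual of type l. *)
Definition first_visit (u : label) : Prop :=
  exists u1 c, [/\ u = rcons u1 c, c.1 = l & visits u1 = 0%N].

Lemma visits_first u : (0 < visits u)%N ->
  exists u1 u2, u = u1 ++ u2 /\ first_visit u1.
Proof.
elim: u => [//|c u IH] /=; have [cl|cl] := eqVneq c.1 l.
  by move=> _; exists [:: c], u; split=> //; exists [::], c.
rewrite /visits /= ?(negbTE cl) ?add0n => /IH [u1 [u2 [-> [u3 [c' [-> cl'
  v3]]]]]].
exists (c :: rcons u3 c'), u2; split=> //; exists (c :: u3), c'; split=> //.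
by rewrite /visits /= (negbTE cl).
Qed.

Lemma visits_size u : (visits u <= size u)%N.
Proof. exact: count_size. Qed.

(** If X > 0 almost surely, no generation of the embedded process is empty: having at most [n]
    visits forces either no visit at all or fewer than [n] visits below some individual of type [l].
    Unbounded visits in turn occur in arbitrarily late generations. *)
Lemma mu_few_visits0 : mu l [set x | few_visits 1 x] = 0%E ->
  mu l [set x | ~ lives keep (of_type l l) x] = 0%E.
Proof.
move=> f0; have mf := measurable_few_visits.
have fn n : mu l [set x | few_visits n x] = 0%E.
  elim: n => [|n IH]; first by apply: mu_empty => x /(_ [::] isT).
  pose A : set families := [set x | exists u,
    label_type l u = l /\ [set x | few_visits n x] (shift u x)].
  have mA : measurable A.
    by apply: (@measurable_exists_shift l _ (fun=> [set x | few_visits n x]))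
      => _; exact: mf.
  apply: (@mu_null_sub _ _ ([set x | few_visits 1 x] `|` A)).
  - exact: mf.
  - by apply: measurableU => //; exact: mf.
  - move=> x fx; have [f1|/existsNP [u /not_implyP [uT /negP]]] := pselect
    (few_visits 1 x).
      by left.
    rewrite ltnS -ltnNge => /visits_last [u1 [c [u2 [uE cl _]]]].
    right; exists (rcons u1 c); split; first by rewrite label_type_rcons.
    move=> v vT; move: uT; rewrite uE intree_cat => /andP[u1T _].
    have := fx (rcons u1 c ++ v); rewrite intree_cat u1T => /(_ vT).
    by rewrite visits_cat -cats1 visits_cat /visits /= cl eqxx addn0; lia.
  - apply: mu_nullU => //.
    by apply: (@mu_exists_shift l _ (fun=> [set x | few_visits n x])) => [_|u
      ->]; [exact: mf|].
apply: (@mu_null_sub _ _ [set x | exists n, few_visits n x]).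
- by apply: measurable_not; exact: measurable_lives.
- by apply: measurable_exists => n; exact: mf.
- move=> x nl; apply: contrapT => /forallNP nf; apply: nl => N.
  have /existsNP [u /not_implyP [uT /negP]] := nf N.+1.
  rewrite ltnS -ltnNge => vu; have [|u1 [c [u2 [uE cl v2]]]] := @visits_last u;
    first by lia.
  move: uT vu; rewrite uE intree_cat visits_cat v2 addn0 => /andP[uT _] vu.
  exists (rcons u1 c); split => //; first by rewrite /of_type label_type_rcons
    cl.
  by have := visits_size (rcons u1 c); lia.
- by apply: mu_null_exists => n; [exact: mf|exact: fn].
Qed.

Definition no_first_visit t (x : families) : Prop :=
  forall u, intree keep x u -> first_visit u -> size u <> t.+1.

Lemma measurable_first_visit_at t : measurable [set x | no_first_visit t x].
Proof.
apply: measurable_forall => u; apply: measurable_imp;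
  first exact: measurable_intree.
exact: measurable_prop.
Qed.

Lemma first_visit_cons c u : first_visit (c :: u) <->
  if c.1 == l then u = [::] else first_visit u.
Proof.
case: eqVneq => [cl|cl]; split.
- move=> [u1 [c'' [e _ v1]]]; case: u1 e v1 => [[_ ->]//|c' u1 /= [cc _]].
  by rewrite /visits /= -cc cl eqxx.
- by move=> ->; exists [::], c.
- move=> [u1 [c'' [e cl'' v1]]]; case: u1 e v1 => [[cc _]|c' u1 /= [cc ->]].
    by move: cl; rewrite cc cl'' eqxx.
  by rewrite /visits /= -cc (negbTE cl) => v1; exists u1, c''.
- move=> [u1 [c'' [-> cl'' v1]]]; exists (c :: u1), c''; split=> //.
  by rewrite /visits /= (negbTE cl).
Qed.

(** First-moment bound: the right-hand side is the mean number of first visits in generation t +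
    1. *)
Lemma mu_no_first_visit t i :
  1 - fine (mu i [set x | no_first_visit t x]) <= first_mean t.+1 i -
    first_mean t i.
Proof.
have mn := measurable_first_visit_at.
have fine01 j (A : set families) : measurable A -> 0 <= fine (mu j A) <= 1.
  by move=> mA; rewrite fine_ge0//= -lee_fin fineK ?mu_fin ?mu_le1.
(* [D t j] is what is required of the subtree of a child of type [j]. A child of type [l] is itself
   the first visit, which is forbidden at t = 0 and excludes later first visits below it when t >
   0. *)
pose D t j : set families :=
  if t is t'.+1 then [set x | j = l \/ no_first_visit t' x] else [set x | j <>
    l].
have mD t' j : measurable (D t' j).
  case: t' => [|t']; first exact: measurable_prop.
  by apply: measurableU; [exact: measurable_prop|exact: mn].
have DE t' i' : mu i' [set x | no_first_visit t' x] =
    Ex i' (pgf keep i' (fun j => fine (mu j (D t' j)))).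
  rewrite -[RHS](branching keep i' (mD t')); congr (mu _ _); apply/seteqP;
    split=> x.
    move=> nx c kc cc; case: t' nx => [|t'] nx /=.
      move=> cl; have := nx [:: c]; rewrite /= kc cc => /(_ isT); apply => //.
      by apply/first_visit_cons; rewrite cl eqxx.
    have [cl|cl] := eqVneq c.1 l; [by left|right] => u uT fu su.
    have := nx (c :: u); rewrite /= kc cc => /(_ uT); apply; last by rewrite su.
    by apply/first_visit_cons; rewrite (negbTE cl).
  move=> Dx [|c u] /= => [_ [[|? ?] [? []]]//|/and3P[kc cc uT]].
  move=> /first_visit_cons; have := Dx c kc cc; case: t' {Dx} => [|t'] /=.
    by case: eqP => // _ _ [u1 [c' [-> _ _]]] [] ; rewrite size_rcons.
  case: eqP => [_ _ -> //|_ [//|nu] fu [su]]; exact: (nu u).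
elim: t i => [|t IH] i; rewrite DE.
  apply: le_trans (Ex_pgf_ge keep i _) _; first by move=> j; exact: fine01.
  rewrite /= subr0; apply: ler_sum => j _; rewrite ler_wpM2l ?M_ge0//.
  case: eqP => [jl|jl]; first by rewrite lerBlDr lerDl fine_ge0.
  by rewrite (@mu_full j [set _ | (j : nat) <> l])//= subrr.
apply: le_trans (Ex_pgf_ge keep i _) _; first by move=> j; exact: fine01.
rewrite [first_mean t.+2 i]/= [first_mean t.+1 i in leRHS]/= -sumrB.
apply: ler_sum => j _; rewrite -mulrBr ler_wpM2l ?M_ge0//.
case: eqP => [jl|jl]; first by rewrite (_ : fine _ = 1) ?subrr// mu_full// => x;
  left.
apply: le_trans (IH j); rewrite lerD2l lerN2; apply: fine_le.
- by apply: mu_fin; exact: mn.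
- by apply: mu_fin; exact: (mD t.+1).
apply: le_measure; rewrite ?inE; [exact: mn|exact: (mD t.+1)|].
by move=> x nx; right.
Qed.

(** Borel-Cantelli: the first-moment bounds telescope to [first_mean n l], which is at most 1. *)
Lemma mu_lives_first_visit : (forall t, first_mean t l <= 1) ->
  mu l [set x | lives keep first_visit x] = 0%E.
Proof.
move=> m1; have mn := measurable_first_visit_at.
pose F t : set families := ~` [set x | no_first_visit t x].
have mF t : measurable (F t) by apply: measurableC; exact: mn.
have mS : measurable (lim_sup_set F).
  apply: bigcapT_measurable => n; exact: bigcup_measurable.
apply: (@mu_null_sub _ _ (lim_sup_set F)) => //; first exact: measurable_lives.
  move=> x lx n _; have [u [uT fu nu]] := lx n.+1; exists (size u).-1 => //=.
    by lia.
  by apply/existsNP; exists u => /(_ uT fu); lia.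
apply: lim_sup_set_cvg0 => //; apply: (@le_lt_trans _ _ 1%E); last exact: ltry.
apply: lime_le; first by apply: is_cvg_nneseries => *; exact: measure_ge0.
apply: nearW => n; apply: (@le_trans _ _ (first_mean n l)%:E);
  last by rewrite lee_fin.
rewrite [X in (_ <= X%:E)%E](_ : _ = \sum_(0 <= t < n) (first_mean t.+1 l -
  first_mean t l)).
  rewrite -sumEFin; apply: lee_sum => t _.
  rewrite mu_compl; last exact: mn.
  by rewrite -(fineK (mu_fin l (mn t))) -EFinB lee_fin mu_no_first_visit.
by rewrite telescope_sumr// subr0.
Qed.

(** Finitely many embedded generations, and first visits confined to a bounded time below every
    individual of type [l], leave no room for late visits. If [l] survived, [lives_cut] would find a
    first visit below which it survives with one visit fewer allowed. *)
Lemma few_visits_not_lives n x : few_visits n x ->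
  (forall u, label_type l u = l -> ~ lives keep first_visit (shift u x)) ->
  ~ lives keep (of_type l l) x.
Proof.
elim: n x => [|n IH] x fx nf; first by have := fx [::] isT.
have /not_lives [N NP] := nf [::] erefl.
move=> /(@lives_cut _ _ first_visit _ N) [//||u [uT fu lu]].
- move=> u uT ul u0; apply: visits_first; case/lastP: u u0 ul {uT} => // u c _.
  rewrite /of_type label_type_rcons /visits => cl.
  by rewrite -cats1 count_cat /= cl eqxx addn1.
have ul : label_type l u = l by case: fu => [u1 [c [-> cl _]]];
  rewrite label_type_rcons.
have uv : (0 < visits u)%N.
  by case: fu => [u1 [c [-> cl _]]]; rewrite -cats1 visits_cat /visits /= cl
    eqxx addn1.
apply: (IH (shift u x)).
- move=> v vT; have := fx (u ++ v); rewrite intree_cat uT visits_cat => /(_ vT);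
  lia.
- by move=> v vl; rewrite shift_shift; apply: nf; rewrite label_type_cat ul.
- by move=> N'; have [v [vT va Nv]] := lu N'; exists v; split => //; move: va;
  rewrite /of_type label_type_cat ul.
Qed.

Lemma mu_lives_type : (forall t, first_mean t l <= 1) ->
  mu l [set x | ~ lives keep (of_type l l) x] <> 0%E ->
  mu l [set x | lives keep (of_type l l) x] = 0%E.
Proof.
move=> m1 nl0; have mf := measurable_few_visits.
have f1 : (0 < mu l [set x | few_visits 1 x])%E.
  by rewrite lt0e measure_ge0 andbT; apply/eqP => f0; apply: nl0;
    exact: mu_few_visits0.
pose F : set families := [set x | lives keep first_visit x].
have mF : measurable F by exact: measurable_lives.
pose A : set families := [set x | exists u, label_type l u = l /\ F (shift u
  x)].
have mA : measurable A by exact: (@measurable_exists_shift l _ (fun=> F)).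
pose U : set families := [set x | forall n, ~ few_visits n x].
have mU : measurable U by apply: measurable_forall => n; apply: measurable_not;
  exact: mf.
apply: (@mu_null_sub _ _ (U `|` A)).
- exact: measurable_lives.
- exact: measurableU.
- move=> x lx; apply: contrapT => /not_orP[/existsNP [n /contrapT fx] nA].
  apply: (few_visits_not_lives fx) lx => u ul lu.
  by apply: nA; exists u.
apply: mu_nullU => //; first exact: mu_unbounded_visits.
apply: (@mu_exists_shift l _ (fun=> F)) => // u ->; exact: mu_lives_first_visit.
Qed.

End embedded.

Lemma mu_null_compl i (A : set families) : measurable A ->
  mu i A = 0%E -> mu i (~` A) = 1%E.
Proof. by move=> mA A0; rewrite mu_compl// A0 sube0. Qed.

(** * Local and global extinction *)

Lemma child_type i x u c keep : well_sized i x -> intree keep x (rcons u c) ->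
  (c.1 <= (label_type i u).+1)%N.
Proof.
move=> wx; rewrite intree_rcons => /and3P[_ _ cc]; rewrite leqNgt;
  apply/negP => tc.
by move: cc; rewrite nth_default// wx.
Qed.

Lemma type_lt_before_visit i l keep x u : well_sized i x -> (i <= l)%N ->
  intree keep x u -> visits l.+1 u = 0%N -> (label_type i u <= l)%N.
Proof.
move=> wx il; elim/last_ind: u => [//|u c IH] uT.
rewrite label_type_rcons -cats1 visits_cat => /eqP;
  rewrite addn_eq0 => /andP[/eqP v0].
have ct := child_type wx uT.
move: (uT); rewrite intree_rcons => /and3P[{}uT _ _].
have tl := IH uT v0; rewrite /visits /=; case: eqVneq => //; lia.
Qed.

(* Types increase by at most one per generation, so the first individual of type
   l + 1 on a line of descent from i <= l is a child of an individual of type l. *)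
Lemma mu_lives_up keep i l : (i <= l)%N ->
  mu i [set x | lives keep (of_type i l) x] = 0%E ->
  mu l.+1 [set x | lives keep (of_type l.+1 l.+1) x] = 0%E ->
  mu i [set x | lives keep (of_type i l.+1) x] = 0%E.
Proof.
move=> il l0 l10.
have mL a : measurable [set x | lives keep a x] by exact: measurable_lives.
pose L : set families := [set x | lives keep (of_type l.+1 l.+1) x].
pose A : set families := [set x | exists u, label_type i u = l.+1 /\ L (shift u
  x)].
have mA : measurable A.
  by apply: (@measurable_exists_shift i _ (fun=> L)) => _; exact: mL.
pose B : set families := [set x | ~ well_sized i x].
have mB : measurable B by apply: measurable_not; exact: measurable_well_sized.
pose C : set families := [set x | lives keep (of_type i l) x].
have mC : measurable C by exact: mL.
apply: (@mu_null_sub _ _ ((B `|` C) `|` A)).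
- exact: mL.
- by apply: measurableU => //; exact: measurableU.
- move=> x lx; apply: contrapT => /not_orP[/not_orP[/contrapT wx /not_lives [N
  NP]] nA].
  (* The bound is [N.+1] because a first visit to l + 1 comes one generation after an individual of
     type [l], which occurs before generation [N]. *)
  have [u uT fu|u uT ul u0|u [uT fu lu]] := @lives_cut _ _ (first_visit l.+1) _
    N.+1 lx.
  + have [u1 [c [uE cl v1]]] := fu; move: uT; rewrite uE => uT.
    have ct := child_type wx uT.
    have uT1 : intree keep x u1 by move: uT; rewrite intree_rcons => /and3P[].
    have tl := type_lt_before_visit wx il uT1 v1.
    by rewrite size_rcons ltnS; apply: NP => //; rewrite /of_type; lia.
  + apply: visits_first; case/lastP: u u0 ul {uT} => // u c _.
    rewrite /of_type label_type_rcons /visits => cl.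
    by rewrite -cats1 count_cat /= cl eqxx addn1.
  + have ul : label_type i u = l.+1.
      by case: fu => [u1 [c [-> cl _]]]; rewrite label_type_rcons.
    apply: nA; exists u; split=> //; apply: lives_mono lu => // v.
    by rewrite /of_type label_type_cat ul.
- apply: mu_nullU => //; first exact: measurableU.
    by apply: mu_nullU => //; exact: mu_well_sized.
  by apply: (@mu_exists_shift i _ (fun=> L)) => [_|u ->]; [exact: mL|].
Qed.

(** A positive mean yields an offspring list of positive probability with a child of type [j]. The
    subtree of that child is independent of the list, so P_i(A) is at least a positive multiple of
    P_j(B). *)
Lemma mu_child_null (keep : pred nat) i j (A B : set families) : keep j -> 0 <
  M i j ->
  measurable A -> measurable B ->
  (forall x, intree keep x [:: (j, 0%N)] -> B (shift [:: (j, 0%N)] x) -> A x) ->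
  mu i A = 0%E -> mu j B = 0%E.
Proof.
move=> kj Mij mA mB BA A0.
have [s [ls sj]] : exists s, 0 < law i s /\ (0 < nth 0%N s j)%N.
  apply: contrapT => /forallNP ns; suff M0 : M i j = 0 by rewrite M0 ltxx in
    Mij.
  apply: EFin_inj; rewrite -meanP /Ex esum1// => s _; congr EFin.
  have [->|l0] := eqVneq (law i s) 0; first by rewrite mul0r.
  have lgt : 0 < law i s by rewrite lt_neqAle eq_sym l0 law_ge0.
  case: (nth 0%N s j) (ns s) => [|n] h; first by rewrite mulr0.
  by exfalso; apply: h.
have C0 : mu i (cylinder [:: [::]] (fun=> s) `&` children_in [:: (j, 0%N)]
  (fun=> B)) = 0%E.
  apply: (@mu_null_sub _ _ A) => //.
    apply: measurableI; first exact: measurable_cylinder.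
    by apply: measurable_children_in.
  move=> x [xs xB]; apply: BA; last by apply: xB; rewrite mem_head.
  by rewrite /= kj /= xs ?mem_head ?sj.
move/eqP: C0; rewrite mu_children//; last by move=> u c; rewrite inE => /eqP ->.
rewrite !big_seq1 mule_eq0 => /orP[/eqP [e]|/eqP //].
by move: ls; rewrite e ltxx.
Qed.

Lemma mu_lives_down (keep : pred nat) i j l : keep j -> 0 < M i j ->
  mu i [set x | lives keep (of_type i l) x] = 0%E ->
  mu j [set x | lives keep (of_type j l) x] = 0%E.
Proof.
move=> kj Mij; apply: (@mu_child_null keep i j) => //;
  try exact: measurable_lives.
move=> x jT lx N; have [u [uT ul Nu]] := lx N; exists ((j, 0%N) :: u);
  split => //.
  by rewrite -cat1s intree_cat jT.
by rewrite /= ltnW.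
Qed.

(** Pairs with i <= l are reached by raising [l] from the diagonal, the others by raising [i] from
    the diagonal along the edges from i to i + 1. *)
Lemma mu_lives_all k : (forall i, 0 < M i i.+1) ->
  (forall l, (k < l)%N -> mu l [set x | lives (fun t => (k < t)%N) (of_type l
    l) x] = 0%E) ->
  forall i l, (k < i)%N -> (k < l)%N ->
  mu i [set x | lives (fun t => (k < t)%N) (of_type i l) x] = 0%E.
Proof.
move=> Mup diag i l ki kl; have [il|li] := leqP i l.
  elim: l il kl => [|l IH]; first by rewrite leqn0 => /eqP i0; move: ki;
    rewrite i0.
  rewrite leq_eqVlt => /orP[/eqP ->|il] kl; first exact: diag.
  by apply: mu_lives_up => //; [apply: IH => //; lia|exact: diag].
elim: i li ki => [//|i IH] li ki.
have [lei|] := ltnP l i; last first.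
  move=> il; have -> : l = i by lia.
  by apply: (@mu_lives_down _ i) => //; apply: diag; lia.
by apply: (@mu_lives_down _ i) => //; apply: IH => //; lia.
Qed.

Definition globally_extinct (x : families) : Prop := ~ lives predT (fun=> True)
  x.

Definition partially_extinct i (x : families) : Prop :=
  forall l, ~ lives predT (of_type i l) x.

Lemma measurable_globally_extinct : measurable [set x | globally_extinct x].
Proof. by apply: measurable_not; exact: measurable_lives. Qed.

Lemma measurable_partially_extinct i : measurable [set x | partially_extinct i
  x].
Proof. by apply: measurable_forall => l; apply: measurable_not;
  exact: measurable_lives. Qed.

Lemma globally_partially_extinct i x : globally_extinct x -> partially_extinct
  i x.
Proof. by move=> gx l lx; apply: gx; apply: lives_mono lx. Qed.

Lemma mu_partially_extinct i : mu i [set x | partially_extinct i x] =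
  (mu i [set x | globally_extinct x] +
   mu i [set x | partially_extinct i x /\ ~ globally_extinct x])%E.
Proof.
have mG := measurable_globally_extinct; have mP := measurable_partially_extinct.
rewrite -measureU//.
- congr (mu i _); apply/seteqP; split=> x /=; last first.
    by case=> [/globally_partially_extinct|[]].
  by move=> px; have [?|?] := pselect (globally_extinct x); [left|right].
- by apply: measurable_and; [exact: mP|exact: measurable_not].
- by apply/seteqP; split=> // x [gx [_]].
Qed.

(* From a late generation on, partial extinction leaves only types > k. *)
Lemma mu_partial_not_global k :
  (forall j, (k < j)%N -> mu j [set x | lives (fun t => (k < t)%N) (fun=> True)
    x] = 0%E) ->
  forall i, mu i [set x | partially_extinct i x /\ ~ globally_extinct x] = 0%E.
Proof.
move=> k0 i; have mL a b := measurable_lives a b.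
pose L : set families := [set x | lives (fun t => (k < t)%N) (fun=> True) x].
pose A : set families := [set x | exists u, (k < label_type i u)%N /\ L (shift
  u x)].
apply: (@mu_null_sub _ _ A).
- apply: measurable_and; first exact: measurable_partially_extinct.
  by apply: measurable_not; exact: measurable_globally_extinct.
- by apply: (@measurable_exists_shift i _ (fun=> L)) => _; exact: mL.
- move=> x [px /contrapT gx].
  have /choice [N NP] (l : nat) := not_lives (px l).
  (* From generation [N0] on, none of the finitely many low types occurs, so a survivor found there
     survives in the killed process. *)
  pose N0 := \max_(l < k.+1) N l.
  have big u : intree predT x u -> (N0 <= size u)%N -> (k < label_type i u)%N.
    move=> uT Nu; rewrite ltnNge; apply/negP => uk.
    have := NP _ u uT erefl; rewrite ltnNge => /negP; apply;
      apply: leq_trans Nu.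
    by rewrite -ltnS in uk; exact: (@leq_bigmax _ (fun l : 'I_k.+1 => N l)
      (Ordinal uk)).
  have [u [uT uN lu]] := lives_level N0 gx.
  exists u; split; first by apply: big => //; rewrite uN.
  move=> n; have [v [vT _ nv]] := lu n; exists v; split => //.
  elim/last_ind: v vT {nv} => [//|v c IH] vcT.
  move: (vcT); rewrite !intree_rcons /= => /andP[vT cc]; rewrite IH//= cc andbT.
  have := big (rcons (u ++ v) c); rewrite label_type_rcons; apply.
    by rewrite -cats1 -catA cats1 intree_cat uT.
  by rewrite size_rcons size_cat uN; lia.
- apply: (@mu_exists_shift i _ (fun=> L)) => [_|u ku]; [exact: mL|exact: k0].
Qed.

Lemma mu_nth_gt0 i b : M i b <= 0 -> mu i [set x | (0 < nth 0%N (x [::]) b)%N]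
  = 0%E.
Proof.
move=> M0; pose A s : set families := [set x | x [::] = s /\ (0 < nth 0%N s
  b)%N].
have mA s : measurable (A s) by exact: (measurable_label [::] (fun s' => s' = s
  /\ (0 < nth 0%N s b)%N)).
apply: (@mu_null_sub _ _ [set x | exists s, A s x]).
- exact: (measurable_label [::] (fun s => 0 < nth 0%N s b)%N).
- exact: measurable_exists.
- by move=> x xb; exists (x [::]).
apply: mu_null_exists => // s; have [sb|sb] := ltnP 0 (nth 0%N s b); last first.
  by apply: mu_empty => x [_]; rewrite ltnNge sb.
apply: (@mu_null_sub _ _ [set x | x [::] = s]).
- exact: mA.
- exact: (measurable_label [::] (fun s' => s' = s)).
- by move=> x [].
rewrite mu_root; congr EFin; apply/eqP; rewrite eq_le law_ge0 andbT -lee_fin.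
apply: (@le_trans _ _ (law i s * (nth 0%N s b)%:R)%:E).
  by rewrite lee_fin ler_peMr ?law_ge0// (ler_nat _ 1).
apply: (@le_trans _ _ (Ex i (fun s => (nth 0%N s b)%:R)));
  last by rewrite meanP lee_fin.
apply: esum_ge; exists [set s]; first by split.
by rewrite fsbig_set1.
Qed.

(* Beyond the last individual able to have children of type <= k, the killed
   process is the whole process: it would be partially but not globally extinct. *)
Lemma mu_killed_lives k : let keep := (fun t => (k < t)%N) in
  finite_sw_block M k ->
  (forall i l, (k < i)%N -> (k < l)%N -> mu i [set x | lives keep (of_type i l)
    x] = 0%E) ->
  (forall i, (k < i)%N -> mu i [set x | partially_extinct i x /\ ~
    globally_extinct x] = 0%E) ->
  forall j, (k < j)%N -> mu j [set x | lives keep (fun=> True) x] = 0%E.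
Proof.
move=> keep finsw loc glob j kj.
(* [F] consists of the high types that can have low children; by finiteness of the block they are
   bounded by some [nF]. *)
pose F a := (k < a)%N /\ exists2 b, (b <= k)%N & 0 < M a b.
have [nF FP] : exists nF, forall a, F a -> (a < nF)%N.
  have /finite_seqP [s sE] : finite_set [set a | F a].
    apply: (@sub_finite_set _ _ [set ab.1 | ab in [set ij : nat * nat |
      [/\ (k < ij.1)%N, (ij.2 <= k)%N & 0 < M ij.1 ij.2]]]);
        last exact: finite_image.
    by move=> a [ka [b bk Mab]]; exists (a, b).
  exists (\max_(a <- s) a).+1 => a Fa; rewrite ltnS;
    apply: leq_bigmax_seq => //.
  by have : [set a | F a] a by []; rewrite sE.
have mL a b := measurable_lives a b.
pose rec i : set families := [set x | exists l, (k < l)%N /\ lives keep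
  (of_type i l) x].
have mrec i : measurable (rec i).
  by apply: measurable_exists => l; apply: measurable_and;
    [exact: measurable_prop|exact: mL].
have rec0 i : (k < i)%N -> mu i (rec i) = 0%E.
  move=> ki; apply: mu_null_exists => l.
    by apply: measurable_and; [exact: measurable_prop|exact: mL].
  have [kl|lk] := pselect (k < l)%N; last by apply: mu_empty => x [].
  apply: (@mu_null_sub _ _ [set x | lives keep (of_type i l) x]).
  - by apply: measurable_and; [exact: measurable_prop|exact: mL].
  - exact: mL.
  - by move=> x [].
  - exact: loc.
pose W i : set families := [set x | lives keep (fun=> True) x /\
  forall v, intree keep x v -> ~ F (label_type i v)].
have mW i : measurable (W i).
  apply: measurable_and; first exact: mL.
  apply: measurable_forall => v; apply: measurable_imp;
    first exact: measurable_intree.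
  exact: measurable_prop.
have typeP i u x : (k < i)%N -> intree keep x u -> (k < label_type i u)%N.
  move=> ki; case/lastP: u => // u c; rewrite intree_rcons label_type_rcons.
  by move=> /and3P[].
(* A low child of an individual whose high type is outside [F]: a null event, since the
   corresponding mean vanishes. *)
pose leak i (b : nat) : set families := [set x | exists v,
  ((k < label_type i v)%N /\ ~ F (label_type i v)) /\
  [set x' | (b <= k)%N /\ (0 < nth 0%N (x' [::]) b)%N] (shift v x)].
have mleak0 b : measurable [set x' : families | (b <= k)%N /\ (0 < nth 0%N (x'
  [::]) b)%N].
  apply: measurable_and; first exact: measurable_prop.
  exact: (measurable_label [::] (fun s => 0 < nth 0%N s b)%N).
have mleak i b : measurable (leak i b).
  by apply: (@measurable_exists_shift i _ (fun=> [set x' | (b <= k)%N /\ (0 <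
    nth 0%N (x' [::]) b)%N])).
have leak0 i b : mu i (leak i b) = 0%E.
  apply: (@mu_exists_shift i _ (fun=> [set x' | (b <= k)%N /\ (0 < nth 0%N (x'
    [::]) b)%N])) => //.
  move=> u [ku nFu]; have [bk|kb] := pselect (b <= k)%N;
    last by apply: mu_empty => x [].
  apply: (@mu_null_sub _ _ [set x | (0 < nth 0%N (x [::]) b)%N]).
  - exact: mleak0.
  - exact: (measurable_label [::] (fun s => 0 < nth 0%N s b)%N).
  - by move=> x [].
  apply: mu_nth_gt0; rewrite leNgt; apply/negP => Mub; apply: nFu.
  by split=> //; exists b.
(* Off the null events, a tree in [W i] has no low descendants and coincides with its killed tree.
   Being locally extinct, it is partially but not globally extinct, which has probability zero. *)
have W0 i : (k < i)%N -> mu i (W i) = 0%E.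
  move=> ki.
  have mleaks : measurable [set x | exists b, leak i b x].
    by apply: measurable_exists => b; exact: mleak.
  have mPG : measurable [set x | partially_extinct i x /\ ~ globally_extinct x].
    apply: measurable_and; first exact: measurable_partially_extinct.
    by apply: measurable_not; exact: measurable_globally_extinct.
  apply: (@mu_null_sub _ _ ((rec i `|` [set x | exists b, leak i b x]) `|`
    [set x | partially_extinct i x /\ ~ globally_extinct x])).
  - exact: mW.
  - by apply: measurableU => //; exact: measurableU.
  - move=> x [lx nF'].
    have [|nrec] := pselect (rec i x); first by left; left.
    have [|/forallNP nleak] := pselect (exists b, leak i b x); [by left;
      right|right].
    have keepT u : intree predT x u -> intree keep x u.
      elim/last_ind: u => [//|u c IH]; rewrite !intree_rcons /= => /andP[/IH uT
        cc].
      rewrite uT cc andbT /=; rewrite /keep ltnNge; apply/negP => ck.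
      apply: (nleak c.1); exists u; split; first by split;
        [exact: typeP uT|exact: nF'].
      by split=> //; rewrite /shift cats0; lia.
    split.
      move=> l ll; have [kl|lk] := ltnP k l.
        apply: nrec; exists l; split=> // N; have [u [uT ul Nu]] := ll N.
        by exists u; split => //; exact: keepT.
      have [u [uT ul _]] := ll 0%N; have := typeP i u x ki (keepT u uT).
      by rewrite ul ltnNge lk.
    by apply; apply: lives_mono lx.
  - apply: mu_nullU => //; last exact: glob.
      exact: measurableU.
    by apply: mu_nullU => //; [exact: rec0|exact: mu_null_exists].
pose late : set families := [set x | exists u, (k < label_type j u)%N /\ W
  (label_type j u) (shift u x)].
have mlate : measurable late by exact: measurable_exists_shift.
have late0 : mu j late = 0%E by apply: mu_exists_shift => // u; exact: W0.
apply: (@mu_null_sub _ _ (rec j `|` late)).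
- exact: mL.
- exact: measurableU.
- move=> x lx; have [|nrec] := pselect (rec j x); [by left|right].
  have /choice [N NP] (a : nat) : exists N, (k < a)%N -> forall u, intree keep
    x u ->
      label_type j u = a -> (size u < N)%N.
    have [ka|] := pselect (k < a)%N; last by exists 0%N.
    have /not_lives [N NP] : ~ lives keep (of_type j a) x by move=> la;
      apply: nrec; exists a.
    by exists N => _ u uT; exact: NP.
  (* By local extinction, all high types below [nF] have left the killed tree by this generation, so
     the subtree of the survivor [u] lies in [W]. *)
  have [u [uT uN lu]] := lives_level (\max_(a < nF) N a) lx.
  exists u; split; first exact: typeP uT.
  split=> // v vT Fv.
  have uvT : intree keep x (u ++ v) by rewrite intree_cat uT.
  have := NP _ (proj1 Fv) _ uvT (label_type_cat j u v); rewrite ltnNge => /negP;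
    apply.
  rewrite size_cat uN; apply: leq_trans (leq_addr _ _).
  exact: (@leq_bigmax _ (fun a : 'I_nF => N a) (Ordinal (FP _ Fv))).
- by apply: mu_nullU => //; exact: rec0.
Qed.

(** * Survival of a supercritical finite block *)

(** Follows from (1 - w)(1 + w) <= 1 and 1 + x + x' <= (1 + x)(1 + x'). With x the weighted number
    of children, it gives 1 - pgf >= x / (1 + x), which is of first order in x. *)
Lemma pgf_survival_le (keep : pred nat) t (w : nat -> R) s : (forall l, 0 <= w
  l <= 1) ->
  pgf keep t (fun l => 1 - w l) s *
    (1 + \sum_(l < t.+2 | keep l) (nth 0%N s l)%:R * w l) <= 1.
Proof.
move=> w01; pose Q (P x : R) := [/\ 0 <= P, 0 <= x & P * (1 + x) <= 1].
suff [] : Q (pgf keep t (fun l => 1 - w l) s)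
            (\sum_(l < t.+2 | keep l) (nth 0%N s l)%:R * w l) by [].
have QM P x P' x' : Q P x -> Q P' x' -> Q (P * P') (x + x').
  move=> [P0 x0 Px] [P0' x0' Px']; split; rewrite ?mulr_ge0 ?addr_ge0//.
  have h : 0 <= P * (1 + x) by rewrite mulr_ge0// addr_ge0.
  have : (P * (1 + x)) * (P' * (1 + x')) <= 1 by rewrite mulr_ile1// mulr_ge0//
    addr_ge0.
  have : 0 <= P * P' * (x * x') by rewrite !mulr_ge0.
  lra.
have Q1 : Q 1 0 by split; rewrite ?addr0 ?mulr1.
rewrite /pgf; apply: (big_ind2 Q) => // l _; have /andP[w0 w1] := w01 l.
elim: (nth 0%N s l) => [|n IH]; first by rewrite expr0 mul0r.
rewrite exprS mulrS [X in Q _ X]mulrDl mul1r; apply: QM => //; split;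
  rewrite ?subr_ge0//.
have : 0 <= w l * w l by rewrite mulr_ge0.
lra.
Qed.

(** The mean is truncated to a finite set [X] of offspring lists on which it still exceeds [v i]. On
    [X] the weighted number of children is at most [K], so the first-order bound loses no more than
    a factor 1 + e K. *)
Lemma survival_step (keep : pred nat) i (v : nat -> R) : (forall l, 0 <= v l) ->
  v i < \sum_(j < i.+2 | keep j) M i j * v j ->
  exists2 e0, 0 < e0 & forall e, 0 < e <= e0 -> (forall l, e * v l <= 1) ->
    fine (Ex i (pgf keep i (fun l => 1 - e * v l))) <= 1 - e * v i.
Proof.
move=> v0; pose r s := \sum_(j < i.+2 | keep j) (nth 0%N s j)%:R * v j.
have r0 s : 0 <= r s by apply: sumr_ge0 => j _; rewrite mulr_ge0.
rewrite -lte_fin -(Ex_mean keep i v0) => /ereal_sup_gt[_ [X [finX _] <-]].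
rewrite fsumEFin// lte_fin; set S := \sum_(s \in X) _ => vS.
pose K := \sum_(s \in X) r s.
have K0 : 0 <= K by apply: fsumr_ge0.
have rK s : X s -> r s <= K.
  move=> Xs; rewrite /K (fsbigD1 s)//= lerDl; exact: fsumr_ge0.
have vK : 0 < v i * K + 1 by rewrite ltr_wpDl// mulr_ge0.
(* What is needed is v_i (1 + e K) <= S; the added 1 keeps the denominator positive. *)
exists ((S - v i) / (v i * K + 1)); first by rewrite divr_gt0// subr_gt0.
move=> e /andP[e0 eb] ev1.
have w01 l : 0 <= e * v l <= 1 by rewrite ev1 mulr_ge0// ltW.
have p01 s : 0 <= pgf keep i (fun l => 1 - e * v l) s <= 1.
  by apply: pgf01 => l; have := w01 l; lra.
have eK : 0 < 1 + e * K by rewrite ltr_pwDl// mulr_ge0// ltW.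
suff : e * v i <= 1 - fine (Ex i (pgf keep i (fun l => 1 - e * v l))) by lra.
rewrite -lee_fin -Ex_compl//.
apply: (@le_trans _ _ (e / (1 + e * K) * S)%:E).
  rewrite lee_fin -mulrA ler_wpM2l ?(ltW e0)// mulrC ler_pdivlMr//.
  by move: eb; rewrite ler_pdivlMr//; lra.
apply: esum_ge; exists X => //.
rewrite fsumEFin// lee_fin /S !fsbig_finite//= mulr_sumr big_seq [leRHS]big_seq.
apply: ler_sum => s; rewrite in_fset_set// inE => Xs.
rewrite mulrCA ler_wpM2l ?law_ge0//.
have erE : \sum_(j < i.+2 | keep j) (nth 0%N s j)%:R * (e * v j) = e * r s.
  by rewrite mulr_sumr; apply: eq_bigr => j _; rewrite mulrCA.
have := p01 s; have : pgf keep i (fun l => 1 - e * v l) s * (1 + e * r s) <= 1.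
  by rewrite -erE; exact: (pgf_survival_le keep i s w01).
set p := pgf _ _ _ _ => pr /andP[p0 p1].
have er : 0 <= e * r s by rewrite mulr_ge0// ltW.
have erK : e * r s <= e * K by rewrite ler_wpM2l ?rK// ltW.
rewrite mulrAC ler_pdivrMr//; apply: (@le_trans _ _ ((1 - p) * (1 + e * r s))).
  by rewrite mulrBl mul1r addrAC lerDr subr_ge0.
by rewrite ler_wpM2l ?subr_ge0// lerD2l.
Qed.

Lemma survival_steps (keep : pred nat) n (v : nat -> R) : (forall l, 0 <= v l)
  ->
  (forall i, (i < n)%N -> 0 < v i -> v i < \sum_(j < i.+2 | keep j) M i j * v
    j) ->
  exists2 e, 0 < e & (forall i, (i < n)%N -> e * v i <= 1) /\
    forall i, (i < n)%N -> (forall l, e * v l <= 1) ->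
      fine (Ex i (pgf keep i (fun l => 1 - e * v l))) <= 1 - e * v i.
Proof.
move=> v0 vM; suff [e0 e00 H] : exists2 e0, 0 < e0 & forall e, 0 < e <= e0 ->
    (forall i, (i < n)%N -> e * v i <= 1) /\
    forall i, (i < n)%N -> (forall l, e * v l <= 1) ->
      fine (Ex i (pgf keep i (fun l => 1 - e * v l))) <= 1 - e * v i.
  by exists e0 => //; apply: H; rewrite e00 lexx.
elim: n vM => [|n IH] vM; first by exists 1.
have [e1 e10 H1] := IH (fun i ni => vM i (ltnW ni)).
have [e2 e20 H2] : exists2 e2, 0 < e2 & forall e, 0 < e <= e2 -> (forall l, e *
  v l <= 1) ->
    fine (Ex n (pgf keep n (fun l => 1 - e * v l))) <= 1 - e * v n.
  have [vn|vn] := ltP 0 (v n); first exact: survival_step (vM n (ltnSn n) vn).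
  have -> : v n = 0 by apply/eqP; rewrite eq_le vn v0.
  exists 1 => // e /andP[e0 _] ev; rewrite mulr0 subr0.
  have p01 s : 0 <= pgf keep n (fun l => 1 - e * v l) s <= 1.
    apply: pgf01 => l; have := ev l; have ev0 : 0 <= e * v l by rewrite
      mulr_ge0// ltW.
    lra.
  rewrite -lee_fin fineK ?Ex_fin// -(Ex1 n); apply: le_Ex => s _.
  by case/andP: (p01 s).
(* The last entry ensures e v_n <= 1. *)
exists (Num.min (Num.min e1 e2) (v n + 1)^-1).
  by rewrite !lt_min e10 e20 invr_gt0 ltr_wpDl.
move=> e; rewrite !le_min => /andP[e0 /andP[/andP[ee1 ee2] ev]].
have [|H11 H12] := H1 e; first by rewrite e0 ee1.
split=> i; rewrite ltnS leq_eqVlt => /orP[/eqP ->|lin].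
- move: ev; rewrite -[(v n + 1)^-1]mul1r ler_pdivlMr ?ltr_wpDl//; nra.
- exact: H11.
- by apply: H2; rewrite e0 ee2.
- exact: H12.
Qed.

Definition died_out keep t (x : families) : Prop :=
  forall u, intree keep x u -> size u <> t.

Lemma measurable_died_out keep t : measurable [set x | died_out keep t x].
Proof.
apply: measurable_forall => u; apply: measurable_imp;
  first exact: measurable_intree.
exact: measurable_prop.
Qed.

(** Since G(1 - e v) <= 1 - e v for the process restricted to types <= k, induction on [t] and
    monotonicity of G keep the probability of dying out by generation [t] below 1 - e v. *)
Lemma mu_not_partially_extinct k (v : nat -> R) : (forall l, 0 <= v l) ->
  (forall l, (k < l)%N -> v l = 0) ->
  (forall i, (i <= k)%N -> 0 < v i -> v i < \sum_(j < i.+2 | (j <= k)%N) M i j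
    * v j) ->
  forall i, 0 < v i -> (mu i [set x | partially_extinct i x] < 1)%E.
Proof.
move=> v0 vk vM; have [e e0 [ev eP]] := @survival_steps (fun j => (j <= k)%N)
  k.+1 v v0 vM.
have {}ev l : e * v l <= 1.
  by have [lk|kl] := leqP l k; [exact: ev|rewrite vk// mulr0].
have ev0 l : 0 <= e * v l by rewrite mulr_ge0// ltW.
set keep := fun j => (j <= k)%N in eP vM.
have mD := measurable_died_out keep.
have dS t x : died_out keep t.+1 x <-> forall c, keep c.1 -> (c.2 < nth 0%N (x
  [::]) c.1)%N ->
    died_out keep t (shift [:: c] x).
  split=> [dx c kc cc u uT ut|dx [//|c u] /= /and3P[kc cc uT] [ut]];
    last exact: (dx c kc cc u).
  by apply: (dx (c :: u)); rewrite /= ?kc ?cc ?ut.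
have d1 t i : (i <= k)%N -> fine (mu i [set x | died_out keep t x]) <= 1 - e *
  v i.
  elim: t i => [|t IH] i ik.
    by rewrite mu_empty ?subr_ge0//= => x /(_ [::] isT).
  apply: le_trans (eP i ik ev).
  have -> : [set x | died_out keep t.+1 x] = [set x | forall c, keep c.1 ->
      (c.2 < nth 0%N (x [::]) c.1)%N -> [set x | died_out keep t x] (shift [::
        c] x)].
    by apply/seteqP; split=> x /dS.
  rewrite (@branching keep i (fun=> [set x | died_out keep t x]))//.
  apply: fine_le.
  - apply: Ex_fin => s; apply: (@pgf01 keep i (fun l => fine (mu l [set x |
    died_out keep t x]))).
    by move=> l; rewrite fine_ge0//= -lee_fin fineK ?mu_fin ?mu_le1.
  - by apply: Ex_fin => s; apply: pgf01 => l; have := ev l; have := ev0 l; lra.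
  apply: le_Ex => s _; apply: (@ler_pgf keep i (fun l => fine (mu l [set x |
    died_out keep t x]))
    (fun l => 1 - e * v l)) => l kl.
  by rewrite fine_ge0//=; exact: IH.
move=> i vi; have ik : (i <= k)%N by rewrite leqNgt; apply/negP => /vk v00;
  rewrite v00 ltxx in vi.
have mP := measurable_partially_extinct i.
pose U : set families := \bigcup_t [set x | died_out keep t x].
have mU : measurable U by apply: bigcupT_measurable => t; exact: mD.
apply: (@le_lt_trans _ _ (1 - e * v i)%:E); last by rewrite lte_fin ltrBlDr
  ltrDl mulr_gt0.
apply: (@le_trans _ _ (mu i U)).
  apply: le_measure; rewrite ?inE//.
  move=> x px; suff /not_lives[t tP] : ~ lives keep (fun=> True) x.
    by exists t => // u uT ut; have := tP u uT I; rewrite ut ltnn.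
  (* Pigeonhole: a restricted tree that survives has only finitely many types available, so one of
     them occurs arbitrarily late. *)
  move=> lx; have /choice [N NP] (l : nat) := not_lives (px l).
  have [u [uT _ Nu]] := lx (\max_(l < k.+1) N l).
  have uT' : intree predT x u by exact: intree_mono uT.
  have uk : (label_type i u < k.+1)%N.
    by case/lastP: u uT {Nu uT'} => // u c; rewrite intree_rcons
      label_type_rcons => /and3P[].
  have := NP _ u uT' erefl; rewrite ltnNge => /negP; apply; apply: leq_trans Nu.
  exact: (@leq_bigmax _ (fun l : 'I_k.+1 => N l) (Ordinal uk)).
have cU : mu i [set x | died_out keep t x] @[t --> \oo] --> mu i U.
  apply: nondecreasing_cvg_mu => //.
  move=> t t' tt'; apply/subsetPset => x dx u uT ut.
  apply: (dx (take t u)); last by rewrite size_take ut; case: ltngtP tt'.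
  by move: uT; rewrite -{1}(cat_take_drop t u) intree_cat => /andP[].
rewrite -(cvg_lim _ cU)//; apply: lime_le; first by apply/cvg_ex; eexists;
  exact: cU.
by apply: nearW => t; rewrite -(fineK (mu_fin i (mD t))) lee_fin; exact: d1.
Qed.

Lemma M_hessenberg i j : (i.+1 < j)%N -> M i j = 0.
Proof.
move=> ij; apply: EFin_inj; rewrite -meanP.
rewrite (@eq_Ex i _ (fun=> 0)); first by rewrite Ex_cst.
by move=> s ss; rewrite nth_default// ss.
Qed.

End canonical.

(** * Spectral radius and convergence norm *)

Section matrices.
Context {R : realType} (M : nat -> nat -> R).
Hypothesis M0 : forall i j, 0 <= M i j.
Hypothesis M_hess : forall i j, (i.+1 < j)%N -> M i j = 0.

Lemma supercritical_vector k : 1 < spectral_radius (nw_block M k) ->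
  exists v : nat -> R, [/\ forall l, 0 <= v l, forall l, (k < l)%N -> v l = 0,
    forall i, (i <= k)%N -> 0 < v i -> v i < \sum_(j < i.+2 | (j <= k)%N) M i j
      * v j &
    exists i, 0 < v i].
Proof.
rewrite /spectral_radius; set S := [set _ | _ in _] => S1.
(* A supremum above 1 is exceeded by no bound 1 on the set; the empty set is ruled out because its
   [sup] is 0. *)
have [x Sx x1] : exists2 x, S x & 1 < x.
  apply: contrapT => /forall2NP nx.
  have Sle : ubound S 1 by move=> x Sx; have [//|/negP] := nx x; rewrite -leNgt.
  have [S0|/set0P/sup_le_ub/(_ Sle)] := eqVneq S set0.
    by move: S1; rewrite S0 sup0 ltr10.
  by rewrite leNgt S1.
case: Sx => l /= + lx; set A := map_mx _ _.
(* [eigenvalue] refers to row vectors. Passing to the transpose, which has the same characteristic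
   polynomial, gives a right eigenvector of the block. *)
have chT : char_poly A = char_poly A^T.
  rewrite /char_poly -det_tr; congr (\det _); apply/matrixP => i j.
  by rewrite !mxE eq_sym.
rewrite eigenvalue_root_char chT -eigenvalue_root_char => /eigenvalueP [w wE
  w0].
pose nv := @ComplexField.Normc.normc R.
have nv0 a : 0 <= nv a by case: a => a b; exact: sqrtr_ge0.
have nvE a : `|a| = (nv a)%:C%C by case: a.
have nvM a b : nv (a * b) = nv a * nv b by exact: ComplexField.Normc.normcM.
have nv_sum (I : finType) (f : I -> R[i]) : nv (\sum_i f i) <= \sum_i nv (f i).
  rewrite -lecR -nvE; apply: le_trans (ler_norm_sum _ _ _) _.
  by rewrite rmorph_sum/=; under eq_bigr do rewrite nvE.
pose v i := if (i <= k)%N then nv (w 0 (inord i)) else 0.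
have vi (i : 'I_k.+1) : v i = nv (w 0 i) by rewrite /v -ltnS ltn_ord inord_val.
have key (i : 'I_k.+1) : nv l * v i <= \sum_(j < k.+1) M i j * v j.
  rewrite vi -nvM; have /rowP/(_ i) := wE; rewrite !mxE => <-.
  apply: le_trans (nv_sum _ _) _; apply: ler_sum => j _.
  rewrite nvM !mxE vi mulrC ler_wpM2r//.
  by rewrite /nv /= expr0n addr0 sqrtr_sqr ger0_norm.
exists v; split.
- by move=> i; rewrite /v; case: ifP.
- by move=> i ki; rewrite /v leqNgt ki.
- move=> i ik vi0; apply: lt_le_trans (_ : nv l * v i <= _).
    by rewrite ltr_pMl// /nv lx.
  have iS : (i < k.+1)%N by [].
  apply: le_trans (key (Ordinal iS)) _ => /=.
  (* The sums over j <= k and over j <= i + 1 are compared on a common range; the extra entries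
     vanish by the Hessenberg shape. *)
  rewrite (big_ord_widen _ (fun j => M i j * v j) (leq_maxl k.+1 i.+2)).
  rewrite (big_ord_widen_cond _ (fun j => (j <= k)%N) (fun j => M i j * v j)
    (leq_maxr k.+1 i.+2)).
  rewrite big_mkcond [leRHS]big_mkcond /=; apply: ler_sum => j _; rewrite ltnS.
  by case: (leqP j k) => //= _; case: ltnP => // ij; rewrite M_hess// mul0r.
- have [j wj] : exists j, w 0 j != 0.
    apply: contrapT => /forallNP nw; move/eqP: w0; apply; apply/rowP => j.
    by rewrite mxE; apply/eqP; rewrite -[_ == _]negbK; apply/negP/nw.
  exists j; rewrite vi lt0r nv0 andbT; apply: contra wj => /eqP.
  by move=> /ComplexField.Normc.eq0_normc ->.
Qed.

Section powers.
Context (keep : pred nat) (l : nat).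

(** The (i, l) entry of the n-th power of [M] with its columns restricted to [keep]. *)
Fixpoint kernel_power (n i : nat) : R :=
  if n is n'.+1 then \sum_(j < i.+2 | keep j) M i j * kernel_power n' j
  else (i == l)%:R.

Lemma kernel_power_ge0 n i : 0 <= kernel_power n i.
Proof. by elim: n i => [|n IH] i /=; [exact: ler0n|apply: sumr_ge0 => j _;
  rewrite mulr_ge0]. Qed.

(** The Green function at [z], truncated at time [T]. *)
Definition green (z : R) (T i : nat) : R := \sum_(n < T.+1) z ^+ n *
  kernel_power n i.

Lemma greenS z T i : green z T.+1 i =
  (i == l)%:R + z * \sum_(j < i.+2 | keep j) M i j * green z T j.
Proof.
rewrite /green big_ord_recl expr0 mul1r; congr (_ + _).
under eq_bigr do rewrite lift0 exprS -mulrA.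
rewrite -mulr_sumr; congr (_ * _).
under eq_bigr do rewrite mulr_sumr.
under [RHS]eq_bigr do rewrite mulr_sumr.
rewrite exchange_big /=; apply: eq_bigr => j _; apply: eq_bigr => n _.
by rewrite mulrCA.
Qed.

Lemma green_ge0 z T i : 0 <= z -> 0 <= green z T i.
Proof. by move=> z0; apply: sumr_ge0 => n _; rewrite mulr_ge0 ?exprn_ge0//
  kernel_power_ge0. Qed.

Lemma green_le z T T' i : 0 <= z -> (T <= T')%N -> green z T i <= green z T' i.
Proof.
move=> z0 /subnK <-; elim: (T' - T)%N => [//|n IH]; apply: le_trans IH _.
by rewrite addSn /green [leRHS]big_ord_recr lerDl mulr_ge0 ?exprn_ge0//
  kernel_power_ge0.
Qed.

(* Decomposition at the first visit to l. *)
Lemma green_first_mean z T t i : 0 <= z <= 1 ->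
  (i == l)%:R + z ^+ t * first_mean M keep l t i * green z T l <= green z (T +
    t) i.
Proof.
move=> /andP[z0 z1]; elim: t i => [|t IH] i.
  rewrite addn0 mulr0 mul0r addr0 /green big_ord_recl expr0 mul1r lerDl.
  by apply: sumr_ge0 => n _; rewrite mulr_ge0 ?exprn_ge0// kernel_power_ge0.
rewrite addnS greenS lerD2l exprS -!mulrA ler_wpM2l//= mulr_suml mulr_sumr.
apply: ler_sum => j _; rewrite -mulrA mulrCA ler_wpM2l//.
have G0 := green_ge0 T l z0.
case: eqP => [->|_].
  rewrite mul1r; apply: (@le_trans _ _ (green z T l)).
    by rewrite ler_piMl// exprn_ile1.
  by apply: green_le => //; rewrite leq_addr.
apply: le_trans (IH j); rewrite mulrA lerDr; exact: ler0n.
Qed.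

(** If some truncated mean m exceeded 1, a z < 1 with z^t m >= 1 would make the Green function at
    [z] grow by 1 every [t] steps. The subexponential bound on the powers makes it converge
    instead. *)
Lemma first_mean_le1 :
  (forall th, 1 < th -> exists N, forall n, (N <= n)%N -> kernel_power n l <=
    th ^+ n) ->
  forall t, first_mean M keep l t l <= 1.
Proof.
move=> pw t; rewrite leNgt; apply/negP => m1;
  set m := first_mean _ _ _ _ _ in m1.
have m0 : 0 < m by exact: lt_trans m1.
have iv1 : m^-1 < 1 by rewrite invf_lt1.
have iv0 : 0 < m^-1 by rewrite invr_gt0.
(* With z = 1 - e, Bernoulli gives z^t >= 1 - t e >= 1/m. Dividing by t + 1 covers t = 0 and keeps e
   below 1. *)
pose e := (1 - m^-1) / t.+1%:R.
have e0 : 0 < e by rewrite divr_gt0// subr_gt0.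
have et : e * t.+1%:R = 1 - m^-1 by rewrite divfK.
have tS : t.+1%:R = t%:R + 1 :> R by rewrite natr1.
have t0 : 0 <= t%:R :> R by [].
have e1 : e < 1 by rewrite tS in et; nra.
pose z := 1 - e; have z0 : 0 < z by rewrite /z; lra.
have z1 : z < 1 by rewrite /z; lra.
have zt : m^-1 <= z ^+ t.
  apply: (@le_trans _ _ (1 - t%:R * e)); first by rewrite tS in et; lra.
  have : forall n, 1 - n%:R * e <= z ^+ n.
    elim=> [|n IH]; first by rewrite mul0r subr0 expr0.
    rewrite exprS; apply: le_trans (ler_wpM2l (ltW z0) IH).
    have : 0 <= n%:R * (e * e) by rewrite mulr_ge0// mulr_ge0 ?(ltW e0).
    by rewrite /z mulrS; lra.
  by apply.
have step T : 1 + green z T l <= green z (T + t) l.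
  have z01 : 0 <= z <= 1 by rewrite !ltW.
  apply: le_trans (green_first_mean T t l z01); rewrite eqxx lerD2l -/m.
  have zm : 1 <= z ^+ t * m by rewrite -ler_pdivrMr// div1r.
  by rewrite ler_peMl// green_ge0// ltW.
have grow n : n%:R <= green z (n * t) l.
  elim: n => [|n IH]; first by rewrite green_ge0// ltW.
  by rewrite mulSn addnC; apply: le_trans (step _); rewrite mulrS lerD2l.
(* Chosen so that th > 1 while z * th < 1. *)
pose th := 2 / (1 + z); pose r := z * th.
have zp : 0 < 1 + z by lra.
have th1 : 1 < th by rewrite ltr_pdivlMr//; lra.
have r0 : 0 <= r by rewrite mulr_ge0 ?ltW// (lt_trans ltr01).
have r1 : r < 1 by rewrite /r /th mulrA ltr_pdivrMr//; lra.
have [N NP] := pw th th1.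
pose C := green z N l + (1 - r)^-1.
have bounded T : green z T l <= C.
  have geo n : (1 - r) * \sum_(i < n) r ^+ i = 1 - r ^+ n.
    elim: n => [|n IH]; first by rewrite big_ord0 mulr0 expr0 subrr.
    by rewrite big_ord_recr /= mulrDr IH exprS; ring.
  apply: (@le_trans _ _ (green z N l + \sum_(i < T.+1) r ^+ i)).
    elim: T => [|T IH].
      by apply: le_trans (green_le l (ltW z0) (leq0n N)) _;
        rewrite lerDl sumr_ge0// => i _; exact: exprn_ge0.
    have [TN|NT] := leqP T.+1 N.
      by apply: le_trans (green_le l (ltW z0) TN) _;
        rewrite lerDl sumr_ge0// => i _; exact: exprn_ge0.
    rewrite {1}/green big_ord_recr [in leRHS]big_ord_recr addrA lerD//.
    rewrite /r exprMn ler_wpM2l//; first by rewrite exprn_ge0// ltW.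
    by apply: NP; exact: ltnW.
  rewrite lerD2l -[leRHS]mul1r ler_pdivlMr ?subr_gt0// mulrC geo gerBl.
  by rewrite exprn_ge0.
have [n nP] : exists n : nat, C < n%:R.
  exists (Num.bound C); apply: archi_boundP.
  by apply: le_trans (bounded 0%N); rewrite green_ge0// ltW.
by have := le_trans (grow n) (bounded _); lra.
Qed.
End powers.
End matrices.

Lemma limn_esup_lt (R : realType) (u : (\bar R)^nat) (a : \bar R) :
  (limn_esup u < a)%E -> exists N, forall n, (N <= n)%N -> (u n < a)%E.
Proof.
rewrite /limn_esup limf_esupE => /ereal_inf_lt[_ [V [N _ VN] <-] Va].
exists N => n Nn; apply: le_lt_trans Va; apply: ereal_sup_ubound.
by exists n => //; exact: VN.
Qed.

Section convergence_norm.
Context {R : realType} (M : nat -> nat -> R) (k : nat).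
Hypothesis M0 : forall i j, 0 <= M i j.
Hypothesis M_hess : forall i j, (i.+1 < j)%N -> M i j = 0.
Let keep t := (k < t)%N.

(** Hessenberg rows have finite support, so the series reduces to a finite sum; the shift by k + 1
    turns its indices into the high types. *)
Lemma matrix_power_se n a b : matrix_power (se_block M k) n a b =
  (kernel_power M keep (b + k.+1) n (a + k.+1))%:E.
Proof.
elim: n a => [|n IH] a /=; first by rewrite eqn_add2r.
rewrite (nneseries_split _ a.+2); last first.
  by move=> c _; rewrite IH -EFinM lee_fin mulr_ge0 ?kernel_power_ge0//;
    exact: M0.
rewrite [X in (_ + X)%E](@eseries0 _ _ (0 + a.+2)%N xpredT); last first.
  by move=> c ac _; rewrite /se_block M_hess ?mul0e//; lia.
rewrite adde0 add0n (eq_bigr (fun c =>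
  (se_block M k a c * kernel_power M keep (b + k.+1) n (c + k.+1))%:E));
    last first.
  by move=> c _; rewrite IH.
rewrite sumEFin; congr EFin.
rewrite -(big_mkord keep (fun j => M (a + k.+1) j * kernel_power M keep (b +
  k.+1) n j)).
rewrite [RHS](big_cat_nat (n := k.+1)) //=; last by lia.
rewrite [X in _ = X + _]big_nat_cond [X in _ = X + _]big_pred0 ?add0r;
  last first.
  by move=> j; apply/negbTE/negP => /andP[/andP[_ jk] kj]; move: kj;
    rewrite /keep /= ltnNge -ltnS jk.
rewrite -[X in _ = \sum_(X <= _ < _ | _) _]add0n big_addn (_ : ((a + k.+1).+2 -
  k.+1)%N = a.+2); last by lia.
rewrite big_nat_cond [RHS]big_nat_cond; apply: congr_big => // j.
by rewrite /keep; lia.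
Qed.

Lemma kernel_power_le l : convergence_norm_le1 (se_block M k) -> (k < l)%N ->
  forall th, 1 < th -> exists N, forall n, (N <= n)%N -> kernel_power M keep l
    n l <= th ^+ n.
Proof.
move=> nu kl th th1; pose a := (l - k.+1)%N.
have al : (a + k.+1 = l)%N by rewrite /a; lia.
have /limn_esup_lt[N NP] : (limn_esup (fun n =>
    matrix_power (se_block M k) n a a `^ (n%:R^-1 : R)) < th%:E)%E.
  by apply: le_lt_trans (nu a a) _; rewrite lte_fin.
(* Taking [N.+1] forces n > 0, so that the exponent 1/n is a genuine inverse. *)
exists N.+1 => n Nn; have := NP n (ltnW Nn); rewrite matrix_power_se al
  poweR_EFin lte_fin.
set x := kernel_power _ _ _ _ _; have x0 : 0 <= x by exact: kernel_power_ge0.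
have n0 : n%:R != 0 :> R by rewrite pnatr_eq0; lia.
move=> /ltW xth.
have -> : x = (x `^ n%:R^-1) `^ n%:R by rewrite -powRrM mulVf// powRr1.
rewrite -powR_mulrn ?(ltW (lt_trans ltr01 th1))//.
by rewrite ge0_ler_powR ?nnegrE ?powR_ge0// (ltW (lt_trans ltr01 th1)).
Qed.

End convergence_norm.

(** * The given process *)

Section offspring_law.
Context {R : realType} (p : nat -> offspring -> R) (M : nat -> nat -> R).
Hypothesis pP : progeny_distributions p.
Hypothesis pM : mean_progeny_matrix p M.

Definition offspring_law (t : nat) (s : seq nat) : R :=
  if size s == t.+2 then p t (nth 0%N s) else 0.

Lemma hessenberg_nth t s : size s = t.+2 -> hessenberg t (nth 0%N s).
Proof. by move=> ss l tl; rewrite nth_default// ss. Qed.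

Lemma offspring_law_ge0 t s : 0 <= offspring_law t s.
Proof.
rewrite /offspring_law; case: eqP => // ss; case: pP => p0 _; apply: p0.
exact: hessenberg_nth.
Qed.

Lemma esum_hessenberg t (g : offspring -> R) :
  (\esum_(r in hessenberg t) (p t r * g r)%:E)%E =
  Ex offspring_law t (fun s => g (nth 0%N s)).
Proof.
rewrite (@reindex_esum _ _ _ [set s | size s = t.+2] _ (nth 0%N)).
  rewrite esum_mkcond /Ex; apply: eq_esum => s _; rewrite /offspring_law.
  by case: eqP => [ss|/eqP ss]; [rewrite mem_set|rewrite memNset ?mul0r//;
    exact/eqP].
split.
- by move=> s /= ss; exact: hessenberg_nth.
- move=> s s'; rewrite !inE /= => ss ss' e.
  by apply: (@eq_from_nth _ 0%N); rewrite ?ss ?ss'// => i _; rewrite e.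
- move=> r hr; exists (mkseq r t.+2); first exact: size_mkseq.
  apply/funext => l; have [lt|tl] := ltnP l t.+2; first by rewrite nth_mkseq.
  by rewrite nth_default ?size_mkseq// hr.
Qed.

Lemma Ex_offspring1 t : Ex offspring_law t (fun=> 1) = 1%E.
Proof.
rewrite -(esum_hessenberg t (fun=> 1)); case: pP => _ /(_ t) <-.
by apply: eq_esum => r _; rewrite mulr1.
Qed.

Context (mu : nat -> {measure set families -> \bar R}).
Hypothesis lawP : branching_law offspring_law mu.

Lemma progeny_gen_pow i j t : progeny_gen p i (fun l => if l == j then t else
  1) =
  fine (Ex offspring_law i (fun s => t ^+ nth 0%N s j)).
Proof.
rewrite /progeny_gen; congr fine.
rewrite (esum_hessenberg i (fun r => \prod_(l < i.+2) (if (l : nat) == j then t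
  else 1) ^+ r l)).
apply: (eq_Ex lawP) => s ss.
have [ji|ij] := ltnP j i.+2.
  rewrite (bigD1 (Ordinal ji)) //= eqxx big1 ?mulr1// => l lj.
  case: eqP => [e|]; last by rewrite expr1n.
  by exfalso; move/eqP: lj; apply; apply: val_inj.
rewrite nth_default ?ss// expr0 big1// => l _; case: eqP => [e|];
  last by rewrite expr1n.
by have := ltn_ord l; rewrite e; lia.
Qed.

Lemma progeny_gen1 i : progeny_gen p i (fun=> 1) = 1.
Proof.
rewrite /progeny_gen (esum_hessenberg i (fun r => \prod_(l < i.+2) 1 ^+ r l)).
rewrite -[RHS]/(fine 1%E) -(Ex_offspring1 i); congr fine;
  apply: (eq_Ex lawP) => s _.
by rewrite big1// => l _; rewrite expr1n.
Qed.

(** For t < 1 and n <= K, the quotient (1 - t^n) / (1 - t) lies between t^K n and n. As t tends to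
    1, the lower bound on finite sets of lists shows that the mean is at most the derivative, in
    particular finite, and the upper bound gives the converse. *)
Lemma Ex_offspring i j : Ex offspring_law i (fun s => (nth 0%N s j)%:R) = (M i
  j)%:E.
Proof.
have qE (t : R) : 0 < t < 1 ->
    ((progeny_gen p i (fun l => if l == j then t else 1) -
      progeny_gen p i (fun=> 1)) / (t - 1))%:E =
    Ex offspring_law i (fun s => (1 - t)^-1 * (1 - t ^+ nth 0%N s j)).
  move=> /andP[t0 t1]; have tn n : 0 <= t ^+ n <= 1 by rewrite exprn_ge0
    ?exprn_ile1 ?ltW.
  rewrite (ExZ lawP); [|by rewrite invr_ge0 subr_ge0 ltW|by move=> s;
    rewrite subr_ge0; case/andP: (tn (nth 0%N s j))].
  rewrite (Ex_compl lawP)// progeny_gen_pow progeny_gen1 -EFinM; congr EFin.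
  by rewrite mulrC -[t - 1]opprB invrN mulNr -mulrN opprB.
have cM : (progeny_gen p i (fun l => if l == j then t else 1) -
  progeny_gen p i (fun=> 1)) / (t - 1) @[t --> (1 : R)^'-] --> M i j by exact:
    pM.
have near01 : \forall t \near (1 : R)^'-, 0 < t < 1.
  near=> t; apply/andP; split; near: t; [exact: nbhs_left_gt|exact:
    nbhs_left_lt].
have up (X : set (seq nat)) : finite_set X ->
    \sum_(s \in X) offspring_law i s * (nth 0%N s j)%:R <= M i j.
  move=> finX; set S := \sum_(s \in X) _.
  pose K := \max_(s <- finmap.enum_fset (fset_set X)) nth 0%N s j.
  have S0 : 0 <= S by apply: fsumr_ge0 => s _;
    rewrite mulr_ge0// offspring_law_ge0.
  have cS : t ^+ K * S @[t --> (1 : R)^'-] --> S.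
    suff : t ^+ K * S @[t --> (1 : R)^'-] --> 1 ^+ K * S by rewrite expr1n
      mul1r.
    apply: cvgMl; apply: cvg_at_left_filter; exact: exprn_continuous.
  apply: (ler_cvg_to cS cM); near=> t.
  have /andP[t0 t1] : 0 < t < 1 by near: t.
  rewrite -lee_fin qE ?t0//; apply: esum_ge; exists X => //.
  rewrite fsumEFin// lee_fin /S !fsbig_finite//= mulr_sumr big_seq
    [leRHS]big_seq.
  apply: ler_sum => s sX; rewrite mulrCA ler_wpM2l ?offspring_law_ge0//.
  rewrite [leRHS]mulrC ler_pdivlMr ?subr_gt0// mulrAC.
  have : forall n, (n <= K)%N -> t ^+ K * (1 - t) * n%:R <= 1 - t ^+ n.
    elim=> [|n IH] nK; first by rewrite mulr0 subrr.
    apply: (@le_trans _ _ (1 - t ^+ n + t ^+ n * (1 - t)));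
      last by rewrite exprS; lra.
    rewrite mulrS mulrDr mulr1 addrC lerD ?IH ?(ltnW nK)//.
    by rewrite ler_wpM2r ?subr_ge0 ?(ltW t1)// ler_wiXn2l ?(ltW t0) ?(ltW t1)//
      ltnW.
  by apply; rewrite /K; exact: leq_bigmax_seq.
have Ele : (Ex offspring_law i (fun s => (nth 0%N s j)%:R) <= (M i j)%:E)%E.
  apply: ge_ereal_sup => _ [X [finX _] <-].
  by rewrite fsumEFin// lee_fin up.
have E0 : (0 <= Ex offspring_law i (fun s => (nth 0%N s j)%:R))%E by apply:
  (Ex_ge0 lawP).
have Efin : Ex offspring_law i (fun s => (nth 0%N s j)%:R) \is a fin_num.
  by rewrite ge0_fin_numE//; apply: le_lt_trans Ele _; exact: ltry.
apply/eqP; rewrite eq_le Ele /= -(fineK Efin) lee_fin.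
apply: (ler_cvg_to cM (cvg_cst _)); near=> t.
have /andP[t0 t1] : 0 < t < 1 by near: t.
rewrite -lee_fin qE ?t0// fineK//; apply: (le_Ex lawP) => s _.
rewrite mulrC ler_pdivrMr ?subr_gt0//; elim: (nth 0%N s j) => [|n IH].
  by rewrite expr0 subrr mul0r.
have tn : t ^+ n <= 1 by rewrite exprn_ile1 ?ltW.
have : t ^+ n * (1 - t) <= 1 - t by rewrite ler_piMl// subr_ge0 ltW.
by rewrite exprS mulrS mulrDl mul1r; lra.
Unshelve. all: by end_near. Qed.
End offspring_law.

(** Cutting each vector after its entry of index t + 1, with t the type, loses nothing almost
    surely: the vector lies in R_t. *)
Definition family_of (x : label -> offspring) (i : nat) : families :=
  fun u => mkseq (x u) (label_type i u).+2.

Section law_of_process.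
Context {d : measure_display} {T : measurableType d} {R : realType}.
Context (P : nat -> probability T R) (xi : label -> T -> offspring).
Context (p : nat -> offspring -> R).
Hypothesis pP : progeny_distributions p.
Hypothesis xiP : is_LHBP P xi p.

Lemma measurable_offspring u (l : nat) (m : nat) : measurable [set w | xi u w l
  = m].
Proof.
case: xiP => mxi _ _; have /(_ measurableT [set m]) := mxi u l.
by rewrite setTI; apply.
Qed.

Lemma measurable_offspring_eq u r : measurable [set w | xi u w = r].
Proof.
rewrite (_ : [set w | _] = [set w | forall l, xi u w l = r l]).
  by apply: measurable_forall => l; exact: measurable_offspring.
by apply/seteqP; split=> w /=; [move=> xr l; rewrite xr|move=> xr;
  apply/funext].
Qed.

Lemma measurable_family_of i : measurable_fun setT (fun w => family_of (xi ^~
  w) i).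
Proof.
apply: (@measurability _ _ T families setT _ cylinders) => // _ [A [->|[us [s
  ->]]] <-].
  by rewrite preimage_set0 setI0.
rewrite setTI; apply: measurable_forall => u; apply: measurable_imp.
  exact: measurable_prop.
rewrite (_ : [set w | _] = [set w | size (s u) = (label_type i u).+2 /\
   forall l, (l < (label_type i u).+2)%N -> xi u w l = nth 0%N (s u) l]).
  apply: measurable_and; first exact: measurable_prop.
  apply: measurable_forall => l; apply: measurable_imp;
    first exact: measurable_prop.
  exact: measurable_offspring.
apply/seteqP; split=> w /=.
  by move=> <-; split; [exact: size_mkseq|move=> l lt; rewrite nth_mkseq].
move=> [ss xs]; apply: (@eq_from_nth _ 0%N); first by rewrite size_mkseq ss.
by move=> l; rewrite size_mkseq => lt; rewrite nth_mkseq// xs.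
Qed.

(** The masses of the vectors in R_t already add up to 1. *)
Lemma hessenberg_as i u : P i [set w | ~ hessenberg (label_type i u) (xi u w)]
  = 0%E.
Proof.
set t := label_type i u.
pose F (s : seq nat) : set T := [set w | size s = t.+2 /\ xi u w = nth 0%N s].
have mF s : measurable (F s).
  by apply: measurable_and; [exact: measurable_prop|exact:
    measurable_offspring_eq].
have mH : measurable [set w | hessenberg t (xi u w)].
  apply: measurable_forall => l; apply: measurable_imp;
    first exact: measurable_prop.
  exact: measurable_offspring.
suff : P i [set w | hessenberg t (xi u w)] = 1%E.
  move=> H1; rewrite (_ : [set w | _] = ~` [set w | hessenberg t (xi u w)])//.
  by rewrite probability_setC// H1 subee.
rewrite (_ : [set w | _] = \bigcup_s F s); last first.
  apply/seteqP; split=> w /=; last by move=> [s _ [ss ->]];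
    exact: hessenberg_nth.
  move=> hw; exists (mkseq (xi u w) t.+2) => //; split; first exact: size_mkseq.
  apply/funext => l; have [lt|tl] := ltnP l t.+2; first by rewrite nth_mkseq.
  by rewrite nth_default ?size_mkseq// hw.
rewrite measure_esum//; last first.
  move=> s s' _ _ [w [[/= ss e] [ss' e']]].
  by apply: (@eq_from_nth _ 0%N); rewrite ?ss ?ss'// => l _; rewrite -e -e'.
rewrite -(Ex_offspring1 pP t); apply: eq_esum => s _;
  rewrite mulr1 /offspring_law.
case: eqP => [ss|ss]; last first.
  by rewrite (_ : F s = set0) ?measure0//; apply/seteqP; split=> // w [].
rewrite (_ : F s = [set w | xi u w = nth 0%N s]); last by apply/seteqP;
  split=> w; [case|].
by case: xiP => _ + _; apply; exact: hessenberg_nth.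
Qed.

Lemma cylinder_law i us (s : label -> seq nat) : uniq us ->
  P i [set w | cylinder us s (family_of (xi ^~ w) i)] =
  (\prod_(u <- us) offspring_law p (label_type i u) (s u))%:E.
Proof.
move=> uus; have mC : measurable [set w | cylinder us s (family_of (xi ^~ w)
  i)].
  rewrite -[X in measurable X]setTI; apply: measurable_family_of => //.
  exact: measurable_cylinder.
have [|/forallNP good] := pselect (exists u, u \in us /\ size (s u) <>
  (label_type i u).+2).
  move=> [u [uu su]]; rewrite (_ : [set w | _] = set0).
    rewrite measure0 (big_rem u)//= /offspring_law.
    by case: eqP su => // _ _; rewrite mul0r.
  by apply/seteqP; split=> // w /(_ u uu) e; apply: su; rewrite -e size_mkseq.
have {}good u : u \in us -> size (s u) = (label_type i u).+2.
  by move=> uu; apply: contrapT => su; exact: (good u).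
pose A := [set w | forall u, u \in us -> xi u w = nth 0%N (s u)].
have mA : measurable A.
  apply: measurable_forall => u; apply: measurable_imp;
    first exact: measurable_prop.
  exact: measurable_offspring_eq.
(* Outside the null set [N], prescribing the truncated lists is the same as prescribing the
   offspring vectors, to which the product rule applies. *)
pose N := [set w | exists u, ~ hessenberg (label_type i u) (xi u w)].
have mNu u : measurable [set w | ~ hessenberg (label_type i u) (xi u w)].
  apply: measurable_not; apply: measurable_forall => l; apply: measurable_imp.
    exact: measurable_prop.
  exact: measurable_offspring.
have mN : measurable N by exact: measurable_exists.
have N0 : (P i).-negligible N.
  rewrite (_ : N = \bigcup_n (if @pickle_inv label n is Some u then
      [set w | ~ hessenberg (label_type i u) (xi u w)] else set0)).
    apply: negligible_bigcup => n; case: pickle_inv => [u|];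
      last exact: negligible_set0.
    by apply/negligibleP => //; exact: hessenberg_as.
  apply/seteqP; split=> w [].
    by move=> u nu; exists (pickle u) => //; rewrite pickleK_inv.
  by move=> n _; case: pickle_inv => // u nu; exists u.
transitivity (P i A); last first.
  case: xiP => _ law indep; rewrite indep// -prodEFin;
    apply: eq_big_seq => u uu.
  by rewrite /offspring_law good// eqxx law//; apply: hessenberg_nth;
    exact: good.
have AC : A `<=` [set w | cylinder us s (family_of (xi ^~ w) i)].
  move=> w Aw u uu; rewrite /family_of Aw//; apply: (@eq_from_nth _ 0%N).
    by rewrite size_mkseq good.
  by move=> l; rewrite size_mkseq => lt; rewrite nth_mkseq.
have CA : [set w | cylinder us s (family_of (xi ^~ w) i)] `<=` A `|` N.
  move=> w Cw; have [Nw|/forallNP hw] := pselect (N w); [by right|left].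
  move=> u uu; rewrite -(Cw u uu); apply/funext => l; rewrite /family_of.
  have [lt|tl] := ltnP l (label_type i u).+2; first by rewrite nth_mkseq.
  by rewrite nth_default ?size_mkseq//; have /contrapT := hw u; apply.
apply/eqP; rewrite eq_le; apply/andP; split; last by apply: le_measure;
  rewrite ?inE.
apply: (@le_trans _ _ (P i (A `|` N))).
  by apply: le_measure; rewrite ?inE//; exact: measurableU.
apply: le_trans (measureU2 _ mA mN) _.
rewrite -[leRHS]adde0; apply: leeD => //; rewrite le_eqVlt; apply/orP; left.
by apply/eqP/negligibleP.
Qed.

End law_of_process.

Lemma intree_generation (keep : pred nat) (x : label -> offspring) i n u :
  (u \in generation keep x i n) = (size u == n) && intree keep (family_of x i)
    u.
Proof.
elim: n u => [|n IH] u /=; first by rewrite inE; case: u.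
rewrite mem_filter; case/lastP: u => [|u c].
  rewrite andbC; apply/negbTE; apply/negP => /andP[/flattenP[_ /mapP[v _ ->]]].
  by move=> /allpairsPdep [l [m [_ _ e]]] _; case: v e.
rewrite label_type_rcons size_rcons eqSS intree_rcons.
have -> : (rcons u c \in flatten [seq children x i v | v <- generation keep x i
  n]) =
    (u \in generation keep x i n) && (c.2 < nth 0%N (family_of x i u) c.1)%N.
  apply/flattenP/andP => [[_ /mapP[v vg ->]] /allpairsPdep [l [m [lt mx
    e]]]|[ug cx]].
    have [-> ->] : u = v /\ c = (l, m) by split; move/rcons_inj: e => [].
    split=> //; move: lt mx; rewrite !mem_iota /= !add0n => lt mx.
    by rewrite nth_mkseq.
  exists (children x i u); first exact: map_f.
  have ct : (c.1 < (label_type i u).+2)%N.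
    rewrite ltnNge; apply/negP => ct; move: cx.
    by rewrite nth_default// size_mkseq.
  apply/allpairsPdep; exists c.1, c.2; rewrite !mem_iota /= !add0n; split=> //.
    by move: cx; rewrite nth_mkseq.
  by case: (c).
by rewrite IH; case: (keep c.1); rewrite ?andbF ?andbT //= -?andbA.
Qed.

(** * Extinction events in terms of family trees *)

Section extinction_events.
Context {R : realType}.
Implicit Types Z : nat -> nat -> nat.

Lemma partial_extinctionP Z : partial_extinction (R := R) Z <->
  forall l, exists N, forall n, (N <= n)%N -> Z n l = 0%N.
Proof.
split=> [Z0 l|Z0 l].
  have /cvgrPdist_lt /(_ 1 ltr01) [N _ NP] := Z0 l.
  exists N => n Nn; have := NP n Nn.
  by rewrite sub0r normrN normr_nat (ltr_nat _ _ 1) ltnS leqn0 => /eqP.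
have [N NP] := Z0 l; apply: (@cvg_near_cst _ _ (0 : R)).
by exists N => // n Nn /=; rewrite NP.
Qed.

(** A total population below 1 forces all its integer summands to vanish, and convergence to 0
    brings the total below 1. *)
Lemma global_extinctionP Z : global_extinction (R := R) Z <->
  exists N, forall n, (N <= n)%N -> forall l, Z n l = 0%N.
Proof.
have Z_ge0 n l : (0 <= ((Z n l)%:R : R)%:E)%E by rewrite lee_fin.
split=> [Z0|[N NP]].
  have [N _ NP] := Z0 _ (open_ereal_lt' lte01); exists N => n Nn l;
    have lt1 := NP n Nn.
  suff : (((Z n l)%:R : R)%:E < 1)%E.
    by rewrite lte_fin (ltr_nat _ _ 1) ltnS leqn0 => /eqP.
  apply: le_lt_trans lt1; apply: le_trans (nneseries_lim_ge l.+1 _) => //.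
  rewrite big_nat_recr//= leeDr// sume_ge0//.
apply: (@cvg_near_cst _ _ (0%E : \bar R)); exists N => // n Nn /=.
by apply/eqP; rewrite eseries0// => l _ _; rewrite NP.
Qed.

Context (keep : pred nat) (x : label -> offspring) (i : nat) (f : nat -> nat).

Let Z n l := count (fun u => label_type i u == f l) (generation keep x i n).

Lemma partial_extinction_lives : partial_extinction (R := R) Z <->
  forall l, ~ lives keep (of_type i (f l)) (family_of x i).
Proof.
rewrite partial_extinctionP; split=> Z0 l.
  have [N NP] := Z0 l => lx; have [u [uT ul Nu]] := lx N.
  have /eqP := NP _ Nu; rewrite -leqn0 leqNgt -has_count => /hasP; apply.
  by exists u; [rewrite intree_generation eqxx|exact/eqP].
have /not_lives [N NP] := Z0 l; exists N => n Nn.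
apply/eqP; rewrite -leqn0 leqNgt -has_count; apply/hasP => -[u].
rewrite intree_generation => /andP[/eqP un uT] /eqP ul.
by have := NP u uT ul; rewrite un ltnNge Nn.
Qed.

Hypothesis fP : forall u, intree keep (family_of x i) u -> exists l, label_type
  i u = f l.

Lemma global_extinction_lives : global_extinction (R := R) Z <->
  ~ lives keep (fun=> True) (family_of x i).
Proof.
rewrite global_extinctionP; split=> [[N NP] lx|].
  have [u [uT _ Nu]] := lx N; have [l ul] := fP uT.
  have /eqP := NP _ Nu l; rewrite -leqn0 leqNgt -has_count => /hasP; apply.
  by exists u; [rewrite intree_generation eqxx|exact/eqP].
move=> /not_lives [N NP]; exists N => n Nn l.
apply/eqP; rewrite -leqn0 leqNgt -has_count; apply/hasP => -[u].
rewrite intree_generation => /andP[/eqP un uT] _.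
by have := NP u uT I; rewrite un ltnNge Nn.
Qed.

End extinction_events.

Theorem theorem8 (R : realType) (d : measure_display) (T : measurableType d)
  (P : nat -> probability T R) (xi : label -> T -> offspring)
  (p : nat -> offspring -> R) (M : nat -> nat -> R) (k : nat) :
  progeny_distributions p ->
  is_LHBP P xi p ->
  mean_progeny_matrix p M ->
  irreducible M ->
  nonsingular p ->
  (forall i : nat, 0 < M i i.+1) ->
  vec_pos (partial_ext_prob P xi) ->
  1 < spectral_radius (nw_block M k) ->
  convergence_norm_le1 (se_block M k) ->
  finite_sw_block M k ->
  (ext_prob P xi = partial_ext_prob P xi /\
   vec_lt (partial_ext_prob P xi) (fun=> 1%E))
  <->
  (killed_ext_prob P xi k = killed_partial_ext_prob P xi k /\
   killed_partial_ext_prob P xi k = (fun=> 1%E)).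
Proof.
move=> pP xiP pM _ _ Mup qpos sp nu fin.
pose X i : {mfun T >-> families} := HB.pack (fun w => family_of (xi ^~ w) i)
  (isMeasurableFun.Build _ _ _ _ (fun w => family_of (xi ^~ w) i)
    (measurable_family_of xiP i)).
pose mu i : {measure set families -> \bar R} := distribution (P i) (X i).
have lawP : branching_law (offspring_law p) mu.
  split=> [t s|t s|i us s uus]; first exact: offspring_law_ge0.
    by rewrite /offspring_law => /negbTE ->.
  exact: (cylinder_law pP xiP).
have meanP := Ex_offspring pP pM lawP.
have M0 := M_ge0 lawP meanP.
pose keep t := (k < t)%N.
have extE i : ext_prob P xi i = mu i [set x | globally_extinct x].
  congr (P i _); apply/seteqP; split=> w /=.
    by move/global_extinction_lives; apply => u _; exists (label_type i u).
  by move=> gx; apply/global_extinction_lives => // u _;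
    exists (label_type i u).
have partE i : partial_ext_prob P xi i = mu i [set x | partially_extinct i x].
  by congr (P i _); apply/seteqP; split=> w /= /partial_extinction_lives.
have typeP x i u : intree keep x u -> exists l, label_type (i + k.+1) u = (l +
  k.+1)%N.
  move=> uT; exists (label_type (i + k.+1) u - k.+1)%N; rewrite subnK//.
  case/lastP: u uT => [_|u c]; first by rewrite /label_type /=; lia.
  by rewrite intree_rcons label_type_rcons => /and3P[].
have kextE i : killed_ext_prob P xi k i = mu (i + k.+1)%N [set x | ~ lives keep
  (fun=> True) x].
  congr (P _ _); apply/seteqP; split=> w /=.
    by move/global_extinction_lives; apply => u; exact: typeP.
  by move=> gx; apply/global_extinction_lives => // u; exact: typeP.
have kpartE i : killed_partial_ext_prob P xi k i =
    mu (i + k.+1)%N [set x | forall l, ~ lives keep (of_type (i + k.+1) (l +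
      k.+1)) x].
  by congr (P _ _); apply/seteqP; split=> w /= /partial_extinction_lives.
have mL a b := measurable_lives a b.
have killed0 : (killed_ext_prob P xi k = killed_partial_ext_prob P xi k /\
    killed_partial_ext_prob P xi k = (fun=> 1%E)) <->
    forall j, (k < j)%N -> mu j [set x | lives keep (fun=> True) x] = 0%E.
  have mN a b : measurable [set x | ~ lives a b x] by apply: measurable_not;
    exact: mL.
  split=> [[e1 e2] j kj|k0].
    have := kextE (j - k.+1)%N; rewrite e1 e2 subnK// => H1.
    rewrite (_ : [set x | _] = ~` [set x | ~ lives keep (fun=> True) x]).
      by rewrite (mu_compl lawP)// -H1 subee.
    by apply/seteqP; split=> x /=; [move=> ? ?|exact: contrapT].
  have k1 i : mu (i + k.+1)%N [set x | ~ lives keep (fun=> True) x] = 1%E.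
    by apply: (mu_null_compl lawP) => //; [exact: mL|apply: k0; lia].
  have -> : killed_ext_prob P xi k = (fun=> 1%E) by apply/funext => i;
    rewrite kextE k1.
  suff -> : killed_partial_ext_prob P xi k = (fun=> 1%E) by [].
  apply/funext => i; rewrite kpartE; apply/eqP; rewrite eq_le; apply/andP;
    split.
    by apply: (mu_le1 lawP); apply: measurable_forall => l; exact: mN.
  rewrite -(k1 i); apply: le_measure; rewrite ?inE//.
    by apply: measurable_forall => l; exact: mN.
  by move=> x nx l lx; apply: nx; apply: lives_mono lx.
have qlt1 : exists i, (partial_ext_prob P xi i < 1)%E.
  have [v [v0 vk vM [i vi]]] := supercritical_vector M0 (M_hessenberg lawP
    meanP) sp.
  by exists i; rewrite partE; exact: (mu_not_partially_extinct lawP meanP v0 vk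
    vM).
have local : forall i l, (k < i)%N -> (k < l)%N -> mu i [set x | lives keep
  (of_type i l) x] = 0%E.
  apply: (mu_lives_all lawP meanP Mup) => l kl.
  apply: (mu_lives_type lawP meanP).
    apply: (first_mean_le1 M0) => th th1.
    exact: (kernel_power_le M0 (M_hessenberg lawP meanP)).
  move=> l0; have := qpos l; rewrite partE ltNge => /negP; apply; rewrite -l0.
  apply: le_measure; rewrite ?inE; [exact: measurable_partially_extinct| |].
    by apply: measurable_not; exact: mL.
  by move=> x px lx; apply: (px l); apply: lives_mono lx.
rewrite killed0; split=> [[qE _]|k0].
  apply: (mu_killed_lives lawP meanP fin local) => i ki.
  have := congr1 (fun q => q i) qE; rewrite extE partE (mu_partially_extinct
    mu).
  have gfin := mu_fin lawP i measurable_globally_extinct.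
  by move=> e; rewrite -[LHS](addeK _ gfin) [X in (X - _)%E]addeC -e subee.
split; last first.
  split=> // i; rewrite partE; apply: (mu_le1 lawP);
    exact: measurable_partially_extinct.
apply/funext => i; rewrite extE partE (mu_partially_extinct mu).
by rewrite (mu_partial_not_global lawP k0) adde0.
Qed.
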